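(* Let $K$ be algebraically closed of characteristic $p=g+1$, where $g>2$ and $g+1$ is prime, and let $\mathcal Z_{d,e,\ell}:\ Y^{g+1}-Y=X^3+dX^2+eX+\ell$ ($d,e,\ell\in K$), a wild non-hyperelliptic $(g+1)$-curve of genus $g$. Let $P_\infty$ be the unique common pole of the coordinate functions $x,y$ in $K(\mathcal Z_{d,e,\ell})$. Then $\mathrm{Aut}(\mathcal Z_{d,e,\ell})$ fixes $P_\infty$, unless $g+1\equiv-1\pmod 3$ and $\mathcal Z_{d,e,\ell}$ is isomorphic to the curve $\mathcal C:\ Y^{g+1}-Y=X^3$, in which case $|\mathrm{Aut}(\mathcal C)|=3g(g+1)(g+2)$. Moreover, if $g\equiv0\pmod3$, then $|\mathrm{Aut}(\mathcal C)|=3g(g+1)$. If $\mathcal Z_{d,e,\ell}$ is not isomorphic to $\mathcal C$, then $|\mathrm{Aut}(\mathcal Z_{d,e,\ell})|\in\{g+1,\,2(g+1),\,3(g+1)\}$.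
   Context: A $q$-curve ($q$ prime) is a curve whose automorphism group contains a subgroup of order $q$; it is wild if $q=p$. Isomorphism of curves means birational equivalence over $K$. *)

(* Defs.v *)
From HB Require Import structures.
From mathcomp Require Import all_boot all_order all_algebra.
Set Implicit Arguments. Unset Strict Implicit. Unset Printing Implicit Defensive.
Import GRing.Theory.
Local Open Scope ring_scope.

(* Function fields of plane curves over K, realized inside a field L
   equipped with an embedding iota : K -> L (L is a "field over K"). *)

Section FF.
Variables (K : fieldType) (L : fieldType) (iota : {rmorphism K -> L}).

Definition generates (x y : L) : Prop :=
  forall S : L -> Prop,
    (forall c : K, S (iota c)) -> S x -> S y ->
    (forall a b, S a -> S b -> S (a + b)) ->
    (forall a, S a -> S (- a)) ->
    (forall a b, S a -> S b -> S (a * b)) ->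
    (forall a, S a -> S a^-1) ->
    forall z, S z.

Definition transcendental (x : L) : Prop :=
  forall q : {poly K}, (map_poly iota q).[x] = 0 -> q = 0.

Definition is_function_field_Z (p : nat) (d e l : K) (x y : L) : Prop :=
  [/\ generates x y, transcendental x &
      y ^+ p - y = x ^+ 3 + iota d * x ^+ 2 + iota e * x + iota l].

(* K-automorphisms of L (= automorphisms of the curve). *)
Definition is_Kaut (f : L -> L) : Prop :=
  [/\ (exists g : L -> L, cancel f g /\ cancel g f),
      (forall a b, f (a + b) = f a + f b),
      (forall a b, f (a * b) = f a * f b),
      f 1 = 1 &
      (forall c : K, f (iota c) = iota c)].

Definition aut_card (n : nat) : Prop :=
  exists e : 'I_n -> (L -> L),
    [/\ (forall i, is_Kaut (e i)), injective e &
        (forall f, is_Kaut f -> exists i, e i = f)].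

(* Places of L/K, given by their valuation rings. *)
Definition is_place (O : L -> Prop) : Prop :=
  [/\ (forall c : K, O (iota c)),
      (forall a b, O a -> O b -> O (a + b)) /\
      (forall a, O a -> O (- a)),
      (forall a b, O a -> O b -> O (a * b)),
      (exists z, ~ O z) &
      (forall z, z != 0 -> O z \/ O z^-1)].

Definition is_pole (O : L -> Prop) (z : L) : Prop := ~ O z.

Definition aut_fixes (O : L -> Prop) : Prop :=
  forall f, is_Kaut f -> forall z, O z <-> O (f z).

End FF.

Definition is_Kiso (K L1 L2 : fieldType) (i1 : {rmorphism K -> L1})
  (i2 : {rmorphism K -> L2}) (f : L1 -> L2) : Prop :=
  [/\ (exists g : L2 -> L1, cancel f g /\ cancel g f),
      (forall a b, f (a + b) = f a + f b),
      (forall a b, f (a * b) = f a * f b),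
      f 1 = 1 &
      (forall c : K, f (i1 c) = i2 c)].

(* The curve with function field (L, iota) is isomorphic (birationally
   equivalent over K) to C : Y^p - Y = X^3. *)
Definition iso_to_C (K L : fieldType) (iota : {rmorphism K -> L}) (p : nat)
  : Prop :=
  exists (L' : fieldType) (iota' : {rmorphism K -> L'}) (x' y' : L'),
    is_function_field_Z iota' p 0 0 0 x' y' /\
    exists f : L' -> L, is_Kiso iota' iota f.

(* Main.v *)
Require Import Defs.
From HB Require Import structures.
From mathcomp Require Import all_boot all_order all_algebra.
From mathcomp Require Import separable cyclotomic boolp zify ring.
Set Implicit Arguments. Unset Strict Implicit. Unset Printing Implicit Defensive.
Import Order.TTheory GRing.Theory Num.Theory.
Local Open Scope ring_scope.

(** Completing the cube and absorbing the constant by an Artin-Schreier substitution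
    brings the curve to [y^p - y = x^3 + a x], with function field [L] free over [K(y)]
    on [1, x, x^2]. The degree of the norm to [K(y)] is a valuation; its ring is the
    only place with [y] among its poles, and the pole orders there of the elements of
    [K[x,y]] form the semigroup generated by [3] and [p]. As [d(y^p - y) = - dy], the
    affine curve is smooth with local parameter [x - x0] at every point, so its local
    rings are valuation rings, with intersection [K[x,y]].

    Let [F] be an automorphism. If [F y] has no affine pole, then [F] preserves
    [K[x,y]] and pole orders at infinity, so [F y] is affine in [y], and the equation
    gives [F x = w x], [F y = w^3 y + b] with [w^(3p) = w^3], [a w^2 = a], [b^p = b].
    Otherwise the pole is a triple one, at a point [(x0,y0)], and [(y - y0)^3 F y] is a
    polynomial of pole order at most 9, hence of the form [A(y) + B(y) x]. Regularity of
    [F y] at the other points over [y0] forces [F y = c + b / (y - y0)] and total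
    ramification over [y0], that is [x0 = a = 0] and [y0^p = y0]. Applying this also to
    the inverse of [F] and to a composite [F o (y |-> y + i) o F] puts [c] and [b] in
    the prime field, and then [(F x / x)^3 = - b / (y - y0)^(p+1)], which is solvable in
    [L] only for [p = 2 mod 3]. The automorphism group is obtained by listing the
    possible values of [(F x, F y)]. *)

(** * The norm to K(y) and its degree *)

Section Triples.
Variables (K : fieldType) (a : K) (p : nat).

(* The triple [(A, B, C)] stands for [A(y) + B(y) x + C(y) x^2] modulo
   [x^3 + a x = y^p - y]. *)
Definition triple : Type := ({poly K} * {poly K} * {poly K})%type.

Definition pev (M : comNzRingType) (j : {rmorphism K -> M}) (v : M) :
  {poly K} -> M := horner_morph (fun c : K => mulrC v (j c)).

HB.instance Definition _ (M : comNzRingType) (j : {rmorphism K -> M}) (v : M) :=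
  GRing.RMorphism.copy (pev j v) (horner_morph (fun c : K => mulrC v (j c))).

Lemma pevC (M : comNzRingType) (j : {rmorphism K -> M}) (v : M) c :
  pev j v c%:P = j c.
Proof. exact: horner_morphC. Qed.

Lemma pevX (M : comNzRingType) (j : {rmorphism K -> M}) (v : M) :
  pev j v 'X = v.
Proof. exact: horner_morphX. Qed.

(** [M] and [j] stay free: [j = iota] gives elements of [L], while [j = idfun] with [(u, v)] a point
    of the curve gives values at that point. *)
Definition tev (M : comNzRingType) (j : {rmorphism K -> M}) (u v : M)
  (r : triple) : M :=
  pev j v r.1.1 + pev j v r.1.2 * u + pev j v r.2 * u ^+ 2.

Definition cpoly : {poly K} := 'X^p - 'X.

Lemma pev_cpoly (M : comNzRingType) (j : {rmorphism K -> M}) (v : M) :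
  pev j v cpoly = v ^+ p - v.
Proof. by rewrite rmorphB rmorphXn /= pevX. Qed.

Definition tadd (r s : triple) : triple :=
  (r.1.1 + s.1.1, r.1.2 + s.1.2, r.2 + s.2).
Definition topp (r : triple) : triple := (- r.1.1, - r.1.2, - r.2).
Definition tscale (q : {poly K}) (r : triple) : triple :=
  (q * r.1.1, q * r.1.2, q * r.2).
(** Products are reduced by [x^3 = c - a' x] and [x^4 = c x - a' x^2]. *)
Definition tmul (r s : triple) : triple :=
  let c := cpoly in let a' := a%:P in
  let: (A, B, C) := r in let: (A', B', C') := s in
  (A * A' + c * (B * C' + C * B'),
   A * B' + B * A' + c * C * C' - a' * (B * C' + C * B'),
   A * C' + B * B' + C * A' - a' * C * C').

(* Determinant of the multiplication by [r] on the basis [1, x, x^2]. *)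
Definition tnorm (r : triple) : {poly K} :=
  let c := cpoly in let a' := a%:P in
  let: (A, B, C) := r in
  A ^+ 3 - 2%:R * a' * A ^+ 2 * C + a' ^+ 2 * A * C ^+ 2 - 3%:R * A * B * C * c
  + a' * A * B ^+ 2 + B ^+ 3 * c + C ^+ 3 * c ^+ 2 + a' * B * C ^+ 2 * c.

(** The cofactors along the first row of the matrix of multiplication by [r]; over [K(y)] this is
    the product of the other two conjugates of [r]. *)
Definition tadj (r : triple) : triple :=
  let c := cpoly in let a' := a%:P in
  let: (A, B, C) := r in
  ((A - a' * C) ^+ 2 - B * (C * c - a' * B),
   C * (C * c - a' * B) - B * (A - a' * C),
   B ^+ 2 - C * (A - a' * C)).

Lemma tnormM r s : tnorm (tmul r s) = tnorm r * tnorm s.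
Proof.
case: r => [[A B] C]; case: s => [[A' B'] C'].
rewrite /tnorm /tmul; move: cpoly a%:P => c a'; ring.
Qed.

Lemma tnorm_scale q r : tnorm (tscale q r) = q ^+ 3 * tnorm r.
Proof.
case: r => [[A B] C]; rewrite /tnorm /tscale /=.
by move: cpoly a%:P => c a'; ring.
Qed.

Lemma tmul_adj r : tmul r (tadj r) = (tnorm r, 0, 0).
Proof.
case: r => [[A B] C]; rewrite /tnorm /tmul /tadj.
by move: cpoly a%:P => c a'; congr (_, _, _); ring.
Qed.

Section Eval.
Variables (M : comNzRingType) (j : {rmorphism K -> M}) (u v : M).
Hypothesis huv : v ^+ p - v = u ^+ 3 + j a * u.
Notation E := (tev j u v).

Lemma tevD r s : E (tadd r s) = E r + E s.
Proof. by rewrite /tev /tadd /= !rmorphD /=; ring. Qed.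

Lemma tevN r : E (topp r) = - E r.
Proof. by rewrite /tev /topp /= !rmorphN /=; ring. Qed.

Lemma tev_scale q r : E (tscale q r) = pev j v q * E r.
Proof. by rewrite /tev /tscale /= !rmorphM /=; ring. Qed.

Lemma tev_poly q : E (q, 0, 0) = pev j v q.
Proof. by rewrite /tev /= !rmorph0 !mul0r !addr0. Qed.

Lemma tevM r s : E (tmul r s) = E r * E s.
Proof.
have hc : pev j v cpoly = u ^+ 3 + j a * u by rewrite pev_cpoly.
case: r => [[A B] C]; case: s => [[A' B'] C'].
rewrite /tev /tmul /=; move: cpoly hc => c hc.
do ![rewrite rmorphD /= | rewrite rmorphM /= | rewrite rmorphN /=].
rewrite pevC hc; ring.
Qed.

Lemma tev_norm r : E r * E (tadj r) = pev j v (tnorm r).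
Proof. by rewrite -tevM tmul_adj tev_poly. Qed.
End Eval.

Section Degree.

Definition sz (q : {poly K}) : nat := size q.

Lemma sz_gt0 q : (0 < sz q)%N = (q != 0).
Proof. exact: size_poly_gt0. Qed.

Lemma szD q q' : (sz (q + q') <= maxn (sz q) (sz q'))%N.
Proof. exact: size_polyD. Qed.

Lemma szN q : sz (- q) = sz q.
Proof. exact: size_polyN. Qed.

Lemma szM q q' : q != 0 -> q' != 0 -> sz (q * q') = (sz q + sz q').-1.
Proof. exact: size_mul. Qed.

Lemma szC c : (sz c%:P <= 1)%N.
Proof. exact: size_polyC_leq1. Qed.

(* For [k = i p]: [q(y) x^i] has a pole of order at most [m] at infinity. *)
Definition bdd (q : {poly K}) (k m : nat) :=
  (q == 0) || (3 * sz q + k <= m + 3)%N.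

Lemma bdd0 k m : bdd 0 k m.
Proof. by rewrite /bdd eqxx. Qed.

Lemma bddD q q' k m : bdd q k m -> bdd q' k m -> bdd (q + q') k m.
Proof.
rewrite /bdd; have [->|_] /= := eqVneq q 0; first by rewrite add0r.
have [->|_] /= := eqVneq q' 0; first by rewrite addr0 => ->; rewrite orbT.
by have := szD q q'; move=> h h1 h2; apply/orP; right; lia.
Qed.

Lemma bddN q k m : bdd q k m -> bdd (- q) k m.
Proof. by rewrite /bdd oppr_eq0 szN. Qed.

Lemma bddM q q' k k' m m' :
  bdd q k m -> bdd q' k' m' -> bdd (q * q') (k + k') (m + m').
Proof.
rewrite /bdd mulf_eq0; have [->|q0] //= := eqVneq q 0.
have [->|q'0] //= := eqVneq q' 0.
rewrite szM //; move: (sz_gt0 q) (sz_gt0 q'); rewrite q0 q'0; lia.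
Qed.

Lemma bddX q k m n : bdd q k m -> bdd (q ^+ n) (k * n) (m * n).
Proof.
move=> h; elim: n => [|n IH]; last by rewrite exprS !mulnS; apply: bddM.
by rewrite expr0 !muln0 /bdd /sz size_poly1 orbT.
Qed.

Lemma bddW q k m k' m' : bdd q k m -> (m + k' <= m' + k)%N -> bdd q k' m'.
Proof. by rewrite /bdd => /orP[->//|h] h'; apply/orP; right; lia. Qed.

Lemma bddC (c : K) : bdd c%:P 0 0.
Proof. by rewrite /bdd; apply/orP; right; have := szC c; lia. Qed.

Lemma szX q n : q != 0 -> sz (q ^+ n) = ((sz q).-1 * n).+1.
Proof.
move=> q0; elim: n => [|n IH]; first by rewrite expr0 /sz size_poly1 muln0.
rewrite exprS szM // ?expf_neq0 // IH mulnS.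
by move: (sz_gt0 q); rewrite q0; lia.
Qed.

Lemma bdd_nat n : bdd n%:R 0 0.
Proof. by rewrite -polyC_natr; apply: bddC. Qed.

Lemma bdd_sum7 k m t1 t2 t3 t4 t5 t6 t7 :
  bdd t1 k m -> bdd t2 k m -> bdd t3 k m -> bdd t4 k m -> bdd t5 k m ->
  bdd t6 k m -> bdd t7 k m -> bdd (t1 - t2 + t3 - t4 + t5 + t6 + t7) k m.
Proof. by move=> *; do ![apply: bddD | apply: bddN]. Qed.

Hypothesis hp1 : (1 < p)%N.

Lemma sz_cpoly : sz cpoly = p.+1.
Proof.
by rewrite /sz /cpoly size_polyDl ?size_polyXn // size_polyN size_polyX.
Qed.

Lemma bdd_cpoly : bdd cpoly 0 (3 * p).
Proof. by rewrite /bdd sz_cpoly; apply/orP; right; lia. Qed.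

Definition tbdd (r : triple) (m : nat) :=
  [&& bdd r.1.1 0 m, bdd r.1.2 p m & bdd r.2 (2 * p) m].

Ltac bterm := repeat first
  [ apply: bddN | apply: bddM | apply: bddX | apply: bddC | apply: bdd_cpoly
  | apply: bdd_nat | eassumption ].

(** The [e]s measure how far each coordinate stays below its bound. A factor [a] costs at least [2p]
    in order, whence the extra 1; the term [A B C c] is tight and gets none. *)
Lemma bdd_norm_aux (A B C : {poly K}) (e1 e2 e3 m : nat) :
  bdd A e1 m -> bdd B (p + e2) m -> bdd C (2 * p + e3) m ->
  [/\ bdd (2%:R * a%:P * A ^+ 2 * C) (2 * e1 + e3 + 1) (3 * m),
      bdd (a%:P ^+ 2 * A * C ^+ 2) (e1 + 2 * e3 + 1) (3 * m),
      bdd (3%:R * A * B * C * cpoly) (e1 + e2 + e3) (3 * m),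
      bdd (a%:P * A * B ^+ 2) (e1 + 2 * e2 + 1) (3 * m) &
      bdd (a%:P * B * C ^+ 2 * cpoly) (e2 + 2 * e3 + 1) (3 * m)].
Proof.
move=> hA hB hC; split; apply: bddW; bterm; lia.
Qed.

Lemma tbdd_norm r m : tbdd r m -> bdd (tnorm r) 0 (3 * m).
Proof.
case: r => [[A B] C] /and3P[hA hB hC]; rewrite /= in hA hB hC.
have hB' : bdd B (p + 0) m by rewrite addn0.
have hC' : bdd C (2 * p + 0) m by rewrite addn0.
have [h1 h2 h3 h4 h5] := bdd_norm_aux hA hB' hC'.
have -> : tnorm (A, B, C) = A ^+ 3 - 2%:R * a%:P * A ^+ 2 * C + a%:P ^+ 2 * A * C ^+ 2
   - 3%:R * A * B * C * cpoly + a%:P * A * B ^+ 2 + B ^+ 3 * cpoly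
   + a%:P * B * C ^+ 2 * cpoly + C ^+ 3 * cpoly ^+ 2.
  by rewrite /tnorm; move: cpoly a%:P => c a'; ring.
apply: bddD; [apply: bdd_sum7 | by apply: (bddW (bddM (bddX 3 hC) (bddX 2 bdd_cpoly)));
  clear; lia];
  [ apply: (bddW (bddX 3 hA))
  | apply: (bddW h1)
  | apply: (bddW h2)
  | apply: (bddW h3)
  | apply: (bddW h4)
  | apply: (bddW (bddM (bddX 3 hB) bdd_cpoly))
  | apply: (bddW h5) ]; clear; lia.
Qed.

Lemma sz_dom T R m : sz T = m.+1 -> bdd R 1 (3 * m) -> sz (T + R) = m.+1.
Proof.
rewrite /bdd => hT /orP[/eqP->|h]; first by rewrite addr0.
rewrite -hT; apply: size_polyDl; move: h; rewrite -/(sz T) -/(sz R) hT.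
lia.
Qed.

Lemma cpoly_neq0 : cpoly != 0.
Proof. by rewrite -sz_gt0 sz_cpoly. Qed.

Definition tdeg_spec (r : triple) :=
  exists m, sz (tnorm r) = m.+1 /\ tbdd r m.

Lemma tdeg_domA A B C m : A != 0 -> (3 * sz A = m + 3)%N ->
  bdd B (p + 1) m -> bdd C (2 * p + 1) m -> tdeg_spec (A, B, C).
Proof.
move=> A0 hm hB hC; have hA : bdd A 0 m by rewrite /bdd; apply/orP; right; lia.
exists m; split; last first.
  by rewrite /tbdd /= hA (bddW hB) ?(bddW hC) //; lia.
have [h1 h2 h3 h4 h5] := bdd_norm_aux hA hB hC.
have -> : tnorm (A, B, C) = A ^+ 3 +
  (a%:P ^+ 2 * A * C ^+ 2 - 2%:R * a%:P * A ^+ 2 * C + a%:P * A * B ^+ 2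
   - 3%:R * A * B * C * cpoly + B ^+ 3 * cpoly + C ^+ 3 * cpoly ^+ 2
   + a%:P * B * C ^+ 2 * cpoly).
  by rewrite /tnorm; move: cpoly a%:P => c a'; ring.
apply: sz_dom; first by rewrite szX //; lia.
apply: bdd_sum7;
  [ apply: (bddW h2)
  | apply: (bddW h1)
  | apply: (bddW h4)
  | apply: (bddW h3)
  | apply: (bddW (bddM (bddX 3 hB) bdd_cpoly))
  | apply: (bddW (bddM (bddX 3 hC) (bddX 2 bdd_cpoly)))
  | apply: (bddW h5) ]; clear; lia.
Qed.

Lemma tdeg_domB A B C m : B != 0 -> (3 * sz B + p = m + 3)%N ->
  bdd A 1 m -> bdd C (2 * p + 1) m -> tdeg_spec (A, B, C).
Proof.
move=> B0 hm hA hC.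
have hB : bdd B (p + 0) m by rewrite /bdd; apply/orP; right; lia.
exists m; split; last first.
  by rewrite /tbdd /= (bddW hA) ?(bddW hB) ?(bddW hC) //; lia.
have [h1 h2 h3 h4 h5] := bdd_norm_aux hA hB hC.
have -> : tnorm (A, B, C) = B ^+ 3 * cpoly +
  (A ^+ 3 - 2%:R * a%:P * A ^+ 2 * C + a%:P ^+ 2 * A * C ^+ 2
   - 3%:R * A * B * C * cpoly + a%:P * A * B ^+ 2 + C ^+ 3 * cpoly ^+ 2
   + a%:P * B * C ^+ 2 * cpoly).
  by rewrite /tnorm; move: cpoly a%:P => c a'; ring.
apply: sz_dom.
  rewrite szM ?expf_neq0 ?cpoly_neq0 // szX // sz_cpoly.
  by move: (sz_gt0 B); rewrite B0; lia.
apply: bdd_sum7;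
  [ apply: (bddW (bddX 3 hA))
  | apply: (bddW h1)
  | apply: (bddW h2)
  | apply: (bddW h3)
  | apply: (bddW h4)
  | apply: (bddW (bddM (bddX 3 hC) (bddX 2 bdd_cpoly)))
  | apply: (bddW h5) ]; clear; lia.
Qed.

Lemma tdeg_domC A B C m : C != 0 -> (3 * sz C + 2 * p = m + 3)%N ->
  bdd A 1 m -> bdd B (p + 1) m -> tdeg_spec (A, B, C).
Proof.
move=> C0 hm hA hB.
have hC : bdd C (2 * p + 0) m by rewrite /bdd; apply/orP; right; lia.
exists m; split; last first.
  by rewrite /tbdd /= (bddW hA) ?(bddW hB) ?(bddW hC) //; lia.
have [h1 h2 h3 h4 h5] := bdd_norm_aux hA hB hC.
have -> : tnorm (A, B, C) = C ^+ 3 * cpoly ^+ 2 +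
  (A ^+ 3 - 2%:R * a%:P * A ^+ 2 * C + a%:P ^+ 2 * A * C ^+ 2
   - 3%:R * A * B * C * cpoly + a%:P * A * B ^+ 2 + B ^+ 3 * cpoly
   + a%:P * B * C ^+ 2 * cpoly).
  by rewrite /tnorm; move: cpoly a%:P => c a'; ring.
apply: sz_dom.
  rewrite szM ?expf_neq0 ?cpoly_neq0 // !szX ?cpoly_neq0 // sz_cpoly.
  by move: (sz_gt0 C); rewrite C0; lia.
apply: bdd_sum7;
  [ apply: (bddW (bddX 3 hA))
  | apply: (bddW h1)
  | apply: (bddW h2)
  | apply: (bddW h3)
  | apply: (bddW h4)
  | apply: (bddW (bddM (bddX 3 hB) bdd_cpoly))
  | apply: (bddW h5) ]; clear; lia.
Qed.

Hypothesis hp3 : (p %% 3 != 0)%N.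

(** Since 3 does not divide [p], the orders [3 deg A], [3 deg B + p] and [3 deg C + 2p] are distinct
    modulo 3. So one summand dominates, and its term [A^3], [B^3 c] or [C^3 c^2] alone gives the
    degree of the norm. *)
Lemma tdegP r : r != (0, 0, 0) -> tdeg_spec r.
Proof.
case: r => [[A B] C] r0.
have [k hk] : exists k, (p = 3 * k + 1 \/ p = 3 * k + 2)%N.
  by exists (p %/ 3)%N; move: hp3; lia.
clear hp3.
(* The weights are the pole orders shifted by 3, so that 0 is free to encode a zero coordinate. *)
have wP (q : {poly K}) (i : nat) : exists w, (q = 0 /\ w = 0%N) \/
    [/\ q != 0, (w = 3 * sz q + i)%N & (0 < sz q)%N].
  have [->|q0] := eqVneq q 0; first by exists 0%N; left.
  by exists (3 * sz q + i)%N; right; rewrite sz_gt0.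
have [wA hA] := wP A 0%N; have [wB hB] := wP B p; have [wC hC] := wP C (2 * p)%N.
have h0 : ~ (wA = 0 /\ wB = 0 /\ wC = 0)%N.
  move=> [zA [zB zC]]; move/eqP: r0; apply.
  case: hA => [[-> _]|[_ ? ?]]; last by exfalso; lia.
  case: hB => [[-> _]|[_ ? ?]]; last by exfalso; lia.
  by case: hC => [[-> _]|[_ ? ?]]; last by exfalso; lia.
have {}hA : (A = 0 /\ wA = 0%N) \/ [/\ A != 0, (wA = 3 * sz A)%N & (0 < sz A)%N].
  by case: hA => [|[? ? ?]]; [left | right; split=> //; lia].
have bw (q : {poly K}) (w i n : nat) : (q = 0 /\ w = 0%N) \/
    [/\ q != 0, (w = 3 * sz q + i)%N & (0 < sz q)%N] ->
    (w < n)%N -> bdd q (i + 1) (n - 3).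
  move=> [[-> _]|[_ h h']] hn; first exact: bdd0.
  by rewrite /bdd; apply/orP; right; lia.
have [[h1 h2]|[[h1 h2]|[h1 h2]]] :
  ((wB < wA /\ wC < wA) \/ (wA < wB /\ wC < wB) \/ (wA < wC /\ wB < wC))%N.
- move: (sz A) (sz B) (sz C) hA hB hC => u v w hA hB hC.
  have {}hA : (wA = 0 \/ wA = 3 * u)%N by case: hA => [[_ ?]|[_ ? _]]; [left|right].
  have {}hB : (wB = 0 \/ wB = 3 * v + p)%N by case: hB => [[_ ?]|[_ ? _]]; [left|right].
  have {}hC : (wC = 0 \/ wC = 3 * w + 2 * p)%N by case: hC => [[_ ?]|[_ ? _]];
    [left|right].
  clear -hk hp1 h0 hA hB hC.
  by case: hk => hk; case: hA => hA; case: hB => hB; case: hC => hC; lia.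
- case: hA h1 h2 => [[_ ->]|[A0 hA A1]] h1 h2; first by exfalso; lia.
  apply: (@tdeg_domA _ _ _ (wA - 3)%N); [by []|lia|exact: bw h1|exact: bw h2].
- case: hB h1 h2 => [[_ ->]|[B0 hB B1]] h1 h2; first by exfalso; lia.
  have {}hA : (A = 0 /\ wA = 0%N) \/ [/\ A != 0, (wA = 3 * sz A + 0)%N & (0 < sz A)%N].
    by case: hA => [|[? ? ?]]; [left | right; split=> //; lia].
  apply: (@tdeg_domB _ _ _ (wB - 3)%N);
    [by []|lia|exact: (bw _ _ 0%N _ hA h1)|exact: bw h2].
- case: hC h1 h2 => [[_ ->]|[C0 hC C1]] h1 h2; first by exfalso; lia.
  have {}hA : (A = 0 /\ wA = 0%N) \/ [/\ A != 0, (wA = 3 * sz A + 0)%N & (0 < sz A)%N].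
    by case: hA => [|[? ? ?]]; [left | right; split=> //; lia].
  apply: (@tdeg_domC _ _ _ (wC - 3)%N);
    [by []|lia|exact: (bw _ _ 0%N _ hA h1)|exact: bw h2].
Qed.

Lemma tnorm_eq0 r : (tnorm r == 0) = (r == (0, 0, 0)).
Proof.
apply/idP/idP => [|/eqP->]; last first.
  by rewrite /tnorm !expr0n /= !(mulr0, mul0r, addr0, subr0).
apply: contraLR => /tdegP[m [h _]].
by rewrite -sz_gt0 h.
Qed.

(** A bound on the norm is thus a bound on each coordinate, a condition stable under sums; this will
    give the ultrametric inequality at infinity. *)
Lemma sz_tnorm_le r m : (sz (tnorm r) <= m.+1)%N <-> tbdd r m.
Proof.
split=> h; last first.
  move: (tbdd_norm h); rewrite /bdd => /orP[/eqP->|]; last by lia.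
  by rewrite /sz size_poly0.
have [->|/tdegP[m' [h' /and3P[hA hB hC]]]] := eqVneq r (0, 0, 0).
  by rewrite /tbdd /= !bdd0.
by rewrite /tbdd (bddW hA) ?(bddW hB) ?(bddW hC) //; lia.
Qed.
End Degree.
End Triples.

(** * Places *)

Section Place.
Variables (K L : fieldType) (iota : {rmorphism K -> L}) (O : L -> Prop).
Hypothesis hO : is_place iota O.

Lemma placeC c : O (iota c). Proof. by case: hO. Qed.
Lemma placeD u v : O u -> O v -> O (u + v).
Proof. by case: hO => _ [h _] _ _ _; apply: h. Qed.
Lemma placeN u : O u -> O (- u).
Proof. by case: hO => _ [_ h] _ _ _; apply: h. Qed.
Lemma placeM u v : O u -> O v -> O (u * v).
Proof. by case: hO => _ _ h _ _; apply: h. Qed.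
Lemma placeB u v : O u -> O v -> O (u - v).
Proof. by move=> hu hv; apply: placeD => //; apply: placeN. Qed.
Lemma place0 : O 0. Proof. by rewrite -(rmorph0 iota); apply: placeC. Qed.
Lemma place1 : O 1. Proof. by rewrite -(rmorph1 iota); apply: placeC. Qed.
Lemma placeX u k : O u -> O (u ^+ k).
Proof.
move=> hu; elim: k => [|k IH]; first by rewrite expr0; apply: place1.
by rewrite exprS; apply: placeM.
Qed.

Lemma placeV u : ~ O u -> O u^-1.
Proof.
have [->|u0] := eqVneq u 0; first by move/(_ place0).
by case: hO => _ _ _ _ /(_ u u0) [|].
Qed.

Lemma place_root u k : O (u ^+ k.+1) -> O u.
Proof.
move=> hk; apply: contrapT => hu; apply: (hu).
have hV := placeV hu.
have u0 : u != 0 by apply/eqP => h; apply: hu; rewrite h; apply: place0.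
have -> : u = u ^+ k.+1 * u^-1 ^+ k by rewrite exprS exprVn mulfK ?expf_neq0.
by apply: placeM => //; apply: placeX.
Qed.

(** A case of the integral closedness of valuation rings, meant for [y^p - y] and [x^3 + a x]:
    divide by a power of [u] if [u] is a pole. *)
Lemma place_integral u c k : O (u ^+ k.+2 + iota c * u) -> O u.
Proof.
move=> hk; apply: contrapT => hu; apply: (hu).
have hV := placeV hu.
have u0 : u != 0 by apply/eqP => h; apply: hu; rewrite h; apply: place0.
have -> : u = (u ^+ k.+2 + iota c * u) * u^-1 ^+ k.+1 - iota c * u^-1 ^+ k.
  rewrite mulrDl !exprVn exprS mulfK ?expf_neq0 //.
  by rewrite exprS invfM mulrA mulfK // addrK.
apply: placeB; apply: placeM => //; try exact: placeX.
exact: placeC.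
Qed.

(** The maximal ideal. Zero is listed apart because the inverse of 0 is 0, which lies in [O]. *)
Definition pmax (u : L) := u = 0 \/ ~ O u^-1.

Lemma pmaxO u : pmax u -> O u.
Proof.
case=> [->|h]; first exact: place0.
by rewrite -[u]invrK; apply: placeV.
Qed.

Lemma pmaxM u v : pmax u -> O v -> pmax (u * v).
Proof.
have [->|u0] := eqVneq u 0; first by rewrite mul0r; left.
have [->|v0] := eqVneq v 0; first by rewrite mulr0; left.
case=> [h|hu hv]; first by rewrite h eqxx in u0.
right=> h; apply: hu; have -> : u^-1 = v * (u * v)^-1; last exact: placeM.
by rewrite invfM [u^-1 * _]mulrC mulrA divff // mul1r.
Qed.

Lemma pmaxN u : pmax u -> pmax (- u).
Proof.
case=> [->|h]; first by rewrite oppr0; left.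
by right; rewrite invrN => h'; apply: h; rewrite -[u^-1]opprK; apply: placeN.
Qed.

Lemma pmaxD u v : pmax u -> pmax v -> pmax (u + v).
Proof.
have aux (u' v' : L) : v' != 0 -> O (u' / v') -> pmax v' -> pmax (u' + v').
  move=> v0 hO' hv; have -> : u' + v' = v' * (u' / v' + 1).
    by rewrite mulrDr mulr1 mulrCA divff // mulr1.
  by apply: pmaxM => //; apply: placeD => //; apply: place1.
have [->|u0] := eqVneq u 0; first by rewrite add0r.
have [->|v0] := eqVneq v 0; first by rewrite addr0.
move=> hu hv; have [h|h] := pselect (O (u / v)); first exact: aux.
rewrite addrC; apply: aux => //.
by rewrite -[v / u]invrK invfM invrK mulrC; apply: placeV.
Qed.

Lemma pmaxB u v : pmax u -> pmax v -> pmax (u - v).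
Proof. by move=> hu hv; apply: pmaxD => //; apply: pmaxN. Qed.

Lemma pmaxC c : pmax (iota c) -> c = 0.
Proof.
case=> [/eqP|]; first by rewrite fmorph_eq0 => /eqP.
by rewrite -fmorphV => /(_ (placeC _)).
Qed.

Lemma pmax_unit u : O u -> ~ pmax u -> O u^-1.
Proof. by move=> _ hu; apply: contrapT => h; apply: hu; right. Qed.

Lemma place_unitD c u : c != 0 -> pmax u -> O (iota c + u)^-1.
Proof.
move=> c0 hu; apply: pmax_unit; first by apply: placeD; [apply: placeC|apply: pmaxO].
move=> h; have := pmaxB h hu; rewrite addrK => /pmaxC h'.
by rewrite h' eqxx in c0.
Qed.

Lemma pmax_inv u : ~ O u -> pmax u^-1.
Proof. by move=> h; right; rewrite invrK. Qed.

Lemma place_pull (f : L -> L) : is_Kaut iota f -> is_place iota (fun z => O (f z)).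
Proof.
case=> [[g [fg gf]] fD fM f1 fC].
have f0 : f 0 = 0 by rewrite -(rmorph0 iota) fC.
split.
- by move=> c; rewrite fC; apply: placeC.
- split=> [u v hu hv|u hu]; first by rewrite fD; apply: placeD.
  have -> : f (- u) = - f u; last exact: placeN.
  by apply/eqP; rewrite -addr_eq0 -fD addrC subrr f0.
- by move=> u v hu hv; rewrite fM; apply: placeM.
- by case: hO => _ _ _ [z hz] _; exists (g z); rewrite gf.
- move=> z z0; have [h|/placeV h] := pselect (O (f z)); [by left|right].
  have fz0 : f z != 0 by apply: contra z0 => /eqP h'; apply/eqP;
    rewrite -(fg z) h' -f0 fg.
  suff -> : f z^-1 = (f z)^-1 by [].
  by apply: (mulfI fz0); rewrite -fM divff // f1 divff.
Qed.
End Place.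

(** [K] is algebraically closed, so an element of [L] algebraic over it is a constant: split [q]
    into linear factors. *)
Lemma closed_root (K : closedFieldType) (L : fieldType)
  (j : {rmorphism K -> L}) (q : {poly K}) (v : L) :
  q != 0 -> pev j v q = 0 -> exists2 c, v = j c & root q c.
Proof.
move=> q0; have [r hr] := closed_field_poly_normal q.
rewrite {1}hr -mul_polyC rmorphM /= pevC => /eqP.
rewrite mulf_eq0 fmorph_eq0 lead_coef_eq0 (negPf q0) /= rmorph_prod /=.
rewrite prodf_seq_eq0 => /hasP[c hc /= h]; exists c.
  by move: h; rewrite rmorphB /= pevC pevX subr_eq0 => /eqP.
by rewrite hr rootZ ?lead_coef_eq0 // root_prod_XsubC.
Qed.

Lemma poly_XsubC_div (K : fieldType) (q : {poly K}) (c : K) :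
  exists2 q1, q = ('X - c%:P) * q1 + q.[c]%:P & (sz q1 <= (sz q).-1)%N.
Proof.
exists (q %/ ('X - c%:P)).
  by rewrite {1}(divp_eq q ('X - c%:P)) modp_XsubC mulrC.
by rewrite /sz size_divp ?polyXsubC_eq0 // size_XsubC subn1.
Qed.

(** * The function field and its place at infinity *)

Section FunctionField.
Variables (K : closedFieldType) (L : fieldType) (iota : {rmorphism K -> L}).
Variables (p : nat) (a : K) (x y : L).
Hypotheses (hp : prime p) (hp4 : (4 < p)%N) (hpK : p \in [pchar K]).
Hypothesis hgen : generates iota x y.
Hypothesis htr : transcendental iota x.
Hypothesis hxy : y ^+ p - y = x ^+ 3 + iota a * x.

Notation E := (tev iota x y).
Notation ev := (pev iota y).
Notation N := (tnorm a p).

Lemma p_mod3 : (p %% 3 != 0)%N.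
Proof.
by apply/negP => h; have := hp4; rewrite -(prime_nt_dvdP hp _ h).
Qed.

Lemma p_gt1 : (1 < p)%N. Proof. by apply: prime_gt1. Qed.

(** If [v] were a constant [r], the cubic [X^3 + a X - (r^p - r)] would vanish at [u]. The pair is
    arbitrary so as to apply to images of [x] and [y] as well. *)
Lemma rel_transc u v q : transcendental iota u ->
  v ^+ p - v = u ^+ 3 + iota a * u -> pev iota v q = 0 -> q = 0.
Proof.
move=> hu huv hq; apply/eqP; apply: contrapT => /negP q0.
have [r hr _] := closed_root q0 hq.
have h : 'X^3 + a%:P * 'X - (r ^+ p - r)%:P = 0 :> {poly K}.
  apply: hu; rewrite rmorphB rmorphD rmorphXn rmorphM /= map_polyX !map_polyC /=.
  rewrite !hornerE /= rmorphB rmorphXn /= -hr huv; ring.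
have := congr1 (fun q : {poly K} => q`_3) h.
by rewrite !coefE /= mulr0 !addr0 subr0 => /eqP; rewrite oner_eq0.
Qed.

Lemma y_transc q : ev q = 0 -> q = 0.
Proof. exact: rel_transc htr hxy. Qed.

Lemma ev_eq0 q : (ev q == 0) = (q == 0).
Proof. by apply/eqP/eqP => [/y_transc|->] //; rewrite rmorph0. Qed.

(** Freeness of [1, x, x^2] over [K[y]]: if [E r] vanishes then so does the norm, a polynomial in
    the transcendental [y], and the norm has only the trivial zero. *)
Lemma tev_eq0 r : (E r == 0) = (r == (0, 0, 0)).
Proof.
apply/idP/idP => [/eqP h|/eqP->]; last by rewrite tev_poly rmorph0.
rewrite -(tnorm_eq0 a p_gt1 p_mod3) -ev_eq0.
by rewrite -(tev_norm hxy) h mul0r.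
Qed.

Lemma tev_inj r s : E r = E s -> r = s.
Proof.
move=> h; have := tev_eq0 (tadd r (topp s)).
rewrite tevD tevN h subrr eqxx => /esym/eqP.
case: r s {h} => [[A B] C] [[A' B'] C'] [] h1 h2 h3.
by congr (_, _, _); apply/eqP; rewrite -subr_eq0; apply/eqP.
Qed.

(** Fractions with denominator in [K[y]] already form a field containing the generators; the
    adjugate turns the denominator of an inverse into a norm. *)
Lemma frac_poly_rep z : exists r q, q != 0 /\ z * ev q = E r.
Proof.
apply: (hgen (S := fun z => exists r q, q != 0 /\ z * ev q = E r)).
- by move=> c; exists (c%:P, 0, 0), 1; rewrite oner_eq0 rmorph1 mulr1 tev_poly pevC.
- exists (0, 1, 0), 1; rewrite oner_eq0 rmorph1 mulr1; split=> //.
  by rewrite /tev /= !rmorph0 rmorph1; ring.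
- by exists ('X, 0, 0), 1; rewrite oner_eq0 rmorph1 mulr1 tev_poly pevX.
- move=> u v [r [q [q0 hr]]] [s [q' [q'0 hs]]].
  exists (tadd (tscale q' r) (tscale q s)), (q * q'); split; first by rewrite mulf_neq0.
  by rewrite tevD !tev_scale -hr -hs rmorphM /=; ring.
- move=> u [r [q [q0 hr]]]; exists (topp r), q; split=> //.
  by rewrite tevN -hr mulNr.
- move=> u v [r [q [q0 hr]]] [s [q' [q'0 hs]]].
  exists (tmul a p r s), (q * q'); split; first by rewrite mulf_neq0.
  by rewrite (tevM hxy) -hr -hs rmorphM /=; ring.
- move=> u [r [q [q0 hr]]]; have [->|u0] := eqVneq u 0.
    by exists (0, 0, 0), 1; rewrite oner_eq0 invr0 mul0r tev_poly rmorph0.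
  have r0 : r != (0, 0, 0) by rewrite -tev_eq0 -hr mulf_neq0 ?ev_eq0.
  exists (tscale q (tadj a p r)), (N r); split;
    first by rewrite (tnorm_eq0 a p_gt1 p_mod3).
  by rewrite tev_scale -(tev_norm hxy) -hr; field.
Qed.

Lemma sz_tnorm_gt0 r : r != (0, 0, 0) -> (0 < sz (N r))%N.
Proof. by rewrite sz_gt0 (tnorm_eq0 a p_gt1 p_mod3). Qed.

Definition ratio_deg (r s : triple K) : int := (sz (N r))%:Z - (sz (N s))%:Z.

(** Cross-multiplying two fractions for [z] gives equal norms, so the degree difference does not
    depend on the fraction. For [z = 0] the condition is vacuous. *)
Lemma ex_pole_order : exists n : L -> int, forall z r s,
  r != (0, 0, 0) -> s != (0, 0, 0) -> z * E s = E r -> n z = ratio_deg r s.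
Proof.
suff h z : exists k, forall r s,
  r != (0, 0, 0) -> s != (0, 0, 0) -> z * E s = E r -> k = ratio_deg r s.
  by have [n hn] := choice h; exists n.
  have [->|z0] := eqVneq z 0.
    by exists 0 => r s r0 _ /eqP; rewrite mul0r eq_sym tev_eq0 (negPf r0).
  have [r [q [q0 hr]]] := frac_poly_rep z.
  exists (ratio_deg r (q, 0, 0)) => r' s' r'0 s'0 h'.
  have r0 : r != (0, 0, 0) by rewrite -tev_eq0 -hr mulf_neq0 ?ev_eq0.
  have q'0 : (q, 0, 0) != (0, 0, 0) :> triple K by rewrite -tev_eq0 tev_poly ev_eq0.
  have : tmul a p r s' = tmul a p r' (q, 0, 0).
    by apply: tev_inj; rewrite !(tevM hxy) -hr -h' tev_poly; ring.
  move/(congr1 (fun t => sz (N t)));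
    rewrite !tnormM !szM ?(tnorm_eq0 a p_gt1 p_mod3) //.
  move: (sz_tnorm_gt0 r0) (sz_tnorm_gt0 s'0) (sz_tnorm_gt0 r'0) (sz_tnorm_gt0 q'0).
  rewrite /ratio_deg; clear; lia.
Qed.

(** Minus the valuation at infinity, so positive at poles. The value at 0 carries no information,
    hence the separate clause in [ord_le]. *)
Definition ord_inf : L -> int := sval (cid ex_pole_order).
Notation n := ord_inf.

Lemma ord_inf_ratio z r s : r != (0, 0, 0) -> s != (0, 0, 0) -> z * E s = E r ->
  n z = ratio_deg r s.
Proof. by rewrite /ord_inf; case: (cid _) => f /= h; apply: h. Qed.

Lemma triple1_neq0 : (1, 0, 0) != (0, 0, 0) :> triple K.
Proof. by rewrite -tev_eq0 tev_poly rmorph1 oner_eq0. Qed.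

Lemma frac_rep z : z != 0 -> exists r s, [/\ r != (0, 0, 0), s != (0, 0, 0) & z * E s =
  E r].
Proof.
move=> z0; have [r [q [q0 hr]]] := frac_poly_rep z; exists r, (q, 0, 0).
by split; rewrite ?tev_poly // -tev_eq0 ?tev_poly ?ev_eq0 // -hr mulf_neq0 ?ev_eq0.
Qed.

Lemma ord_inf_tev r : r != (0, 0, 0) -> n (E r) = (sz (N r)).-1%:Z.
Proof.
move=> r0; rewrite (ord_inf_ratio (r := r) (s := (1, 0, 0))) ?triple1_neq0 //;
  last first.
  by rewrite tev_poly rmorph1 mulr1.
have h1 : sz (N (1, 0, 0)) = 1%N.
  have -> : N (1, 0, 0) = 1 by rewrite /tnorm; move: (cpoly _ _) => c; ring.
  exact: size_poly1.
by rewrite /ratio_deg h1; move: (sz_tnorm_gt0 r0); clear; lia.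
Qed.

Lemma ord_infM u v : u != 0 -> v != 0 -> n (u * v) = n u + n v.
Proof.
move=> /frac_rep[r [s [r0 s0 h]]] /frac_rep[r' [s' [r'0 s'0 h']]].
rewrite (ord_inf_ratio r0 s0 h) (ord_inf_ratio r'0 s'0 h').
have m0 (t t' : triple K) : t != (0, 0, 0) -> t' != (0, 0, 0) -> tmul a p t t' != (0,
  0, 0).
  by rewrite -!tev_eq0 (tevM hxy) => *; apply: mulf_neq0.
rewrite (@ord_inf_ratio _ (tmul a p r r') (tmul a p s s')) ?m0 //; last first.
  by rewrite !(tevM hxy) -h -h'; ring.
rewrite /ratio_deg !tnormM !szM ?(tnorm_eq0 a p_gt1 p_mod3) //.
move: (sz_tnorm_gt0 r0) (sz_tnorm_gt0 s'0) (sz_tnorm_gt0 r'0) (sz_tnorm_gt0 s0).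
clear; lia.
Qed.

Lemma ord_inf1 : n 1 = 0.
Proof.
have := @ord_infM 1 1 (oner_neq0 L) (oner_neq0 L); rewrite mulr1.
by move: (n 1) => k; clear; lia.
Qed.

Lemma ord_infV u : u != 0 -> n u^-1 = - n u.
Proof.
move=> u0; have := @ord_infM u u^-1 u0; rewrite invr_eq0 divff // ord_inf1 => /(_ u0).
by clear; lia.
Qed.

Lemma ord_infX u k : u != 0 -> n (u ^+ k) = n u * k%:Z.
Proof.
move=> u0; elim: k => [|k IH]; first by rewrite expr0 ord_inf1 mulr0.
by rewrite exprS ord_infM ?expf_neq0 // IH; clear; lia.
Qed.

Definition ord_le (u : L) (m : int) := u = 0 \/ n u <= m.

Lemma ord_le_tev r (m : nat) : ord_le (E r) m%:Z <-> tbdd p r m.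
Proof.
rewrite -(sz_tnorm_le a p_gt1 p_mod3).
have [->|r0] := eqVneq r (0, 0, 0).
  split=> _; last by left; rewrite tev_poly rmorph0.
  by have /eqP-> : N (0, 0, 0) == 0 by [rewrite (tnorm_eq0 a p_gt1 p_mod3)];
    rewrite /sz size_poly0.
rewrite /ord_le ord_inf_tev //; split=> [[/eqP|]|h];
  first by rewrite tev_eq0 (negPf r0).
  by clear; lia.
by right; clear -h; lia.
Qed.

Lemma ord_leM u v m k : ord_le u m -> ord_le v k -> ord_le (u * v) (m + k).
Proof.
have [->|u0] := eqVneq u 0; first by rewrite mul0r; left.
have [->|v0] := eqVneq v 0; first by rewrite mulr0; left.
case=> [/eqP|hu]; first by rewrite (negPf u0).
case=> [/eqP|hv]; first by rewrite (negPf v0).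
by right; rewrite ord_infM // lerD.
Qed.

Lemma ord_leX u m k : ord_le u m -> ord_le (u ^+ k) (m * k%:Z).
Proof.
have [->|u0] := eqVneq u 0.
  move=> _; case: k => [|k]; last by rewrite expr0n; left.
  by right; rewrite expr0 ord_inf1 mulr0.
case=> [/eqP|hu]; first by rewrite (negPf u0).
by right; rewrite ord_infX //; clear -hu; nia.
Qed.

Lemma ord_leW u m k : ord_le u m -> m <= k -> ord_le u k.
Proof. by case=> [->|h h']; [left | right; apply: le_trans h h']. Qed.

(** Over a common denominator in [K[y]] the bound becomes [tbdd], which is checked coordinate by
    coordinate. *)
Lemma ord_leD u v m : ord_le u m -> ord_le v m -> ord_le (u + v) m.
Proof.
have [r [q [q0 hr]]] := frac_poly_rep u; have [s [q' [q'0 hs]]] := frac_poly_rep v.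
have Q0 : ev (q * q') != 0 by rewrite ev_eq0 mulf_neq0.
have hu : u * ev (q * q') = E (tscale q' r).
  by rewrite tev_scale -hr rmorphM /=; ring.
have hv : v * ev (q * q') = E (tscale q s).
  by rewrite tev_scale -hs rmorphM /=; ring.
move=> lu lv; have [->|u0] := eqVneq u 0; first by rewrite add0r.
have [w0|w0] := eqVneq (u + v) 0; first by left.
have lQ : ord_le (ev (q * q')) (n (ev (q * q'))) by right.
have := ord_leM lu lQ; have := ord_leM lv lQ; rewrite hu hv.
(* The bound is a natural number because it dominates the order of a nonzero numerator in
   [K[x,y]]. *)
have [M hM] : exists M : nat, m + n (ev (q * q')) = M%:Z.
  case: lu => [/eqP|lu]; first by rewrite (negPf u0).
  have hs0 : tscale q' r != (0, 0, 0) by rewrite -tev_eq0 -hu mulf_neq0.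
  have := ord_inf_tev hs0; rewrite -hu ord_infM // => h.
  exists (absz (m + n (ev (q * q')))%R); clear -h lu; lia.
rewrite hM => /ord_le_tev h1 /ord_le_tev h2.
have : ord_le (E (tadd (tscale q' r) (tscale q s))) M%:Z.
  apply/ord_le_tev; case/and3P: h1 => h11 h12 h13; case/and3P: h2 => h21 h22 h23.
  by rewrite /tbdd /tadd /= !bddD.
rewrite tevD -hu -hv -mulrDl -hM => -[/eqP|h].
  by rewrite mulf_eq0 (negPf w0) (negPf Q0).
by right; move: h; rewrite ord_infM // lerD2r.
Qed.

Lemma ord_leC c : ord_le (iota c) 0.
Proof.
rewrite -(pevC iota y) -(tev_poly iota x); apply/ord_le_tev.
by rewrite /tbdd /= !bdd0 bddC.
Qed.

Lemma ord_leN u m : ord_le u m -> ord_le (- u) m.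
Proof. by move=> h; rewrite -mulN1r -(rmorphN1 iota) -[m]add0r; apply: ord_leM => //;
  apply: ord_leC. Qed.

Lemma ord_leB u v m : ord_le u m -> ord_le v m -> ord_le (u - v) m.
Proof. by move=> *; apply: ord_leD => //; apply: ord_leN. Qed.

Lemma x_neq0 : x != 0.
Proof.
apply/eqP => h; have /htr/eqP : (map_poly iota 'X).[x] = 0 by rewrite map_polyX hornerX.
by rewrite polyX_eq0.
Qed.

Lemma y_neq0 : y != 0.
Proof.
apply/eqP => h; have /y_transc/eqP : ev 'X = 0 by rewrite pevX.
by rewrite polyX_eq0.
Qed.

Lemma y_subC_neq0 c : y - iota c != 0.
Proof.
by rewrite -(pevX iota y) -(pevC iota y c) -rmorphB ev_eq0 polyXsubC_eq0.
Qed.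

Lemma ord_inf_yC c : n (y - iota c) = 3.
Proof.
have h : N ('X - c%:P, 0, 0) = ('X - c%:P) ^+ 3.
  by rewrite /tnorm; move: (cpoly _ _) ('X - _) => q r; ring.
have -> : y - iota c = E ('X - c%:P, 0, 0) by rewrite tev_poly rmorphB /= pevX pevC.
rewrite ord_inf_tev; last by rewrite -tev_eq0 tev_poly ev_eq0 polyXsubC_eq0.
by rewrite h /sz size_exp_XsubC.
Qed.

Lemma ord_inf_y : n y = 3.
Proof. by have := ord_inf_yC 0; rewrite rmorph0 subr0. Qed.

Lemma ord_inf_x : n x = p%:Z.
Proof.
have h : N (0, 1, 0) = cpoly K p.
  by rewrite /tnorm; move: (cpoly _ _) => q; ring.
have e : x = E (0, 1, 0) by rewrite /tev /= !rmorph0 rmorph1; ring.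
by rewrite {1}e ord_inf_tev ?h ?sz_cpoly ?p_gt1 // -tev_eq0 -e x_neq0.
Qed.

Lemma place_inf : is_place iota (fun z => ord_le z 0).
Proof.
split; first exact: ord_leC.
- by split=> *; [apply: ord_leD | apply: ord_leN].
- by move=> u v hu hv; rewrite -[0]addr0; apply: ord_leM.
- by exists y => -[/eqP|]; rewrite ?(negPf y_neq0) // ord_inf_y.
- move=> z z0; have [h|h] := lerP (n z) 0; [by left; right|right; right].
  by rewrite ord_infV //; clear -h; lia.
Qed.

(** * Uniqueness of the place where [y] has a pole *)

Section AtInfinity.
Variable O : L -> Prop.
Hypothesis hO : is_place iota O.
Hypothesis hy : ~ O y.

Lemma inf_x : ~ O x.
Proof.
move=> hx; apply: hy; have hp2 : p = p.-2.+2 by move: p_gt1; clear; lia.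
apply: (place_integral hO (c := -1) (k := p.-2)); rewrite -hp2 rmorphN1 mulN1r hxy.
by apply: (placeD hO) => //; [apply: (placeX hO)|apply: (placeM hO) => //;
  apply: (placeC hO)].
Qed.

(** As [1/y] is in the maximal ideal, the quotient is congruent to the leading coefficient of [q],
    hence a unit. *)
Lemma inf_poly q : q != 0 ->
  O (ev q / y ^+ (sz q).-1) /\ ~ pmax O (ev q / y ^+ (sz q).-1).
Proof.
have hm : pmax O y^-1 by apply: pmax_inv.
suff h (k : nat) (r : {poly K}) : (sz r <= k.+1)%N ->
    exists2 u, pmax O u & ev r / y ^+ k = iota r`_k + u.
  move=> q0; have hs : (sz q <= (sz q).-1.+1)%N by clear; lia.
  have [u hu ->] := h _ _ hs.
  have l0 : q`_(sz q).-1 != 0 by rewrite -/(lead_coef q) lead_coef_eq0.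
  split; first by apply: (placeD hO) => //; [apply: (placeC hO)|apply: (pmaxO hO)].
  move=> h1; have := pmaxB hO h1 hu; rewrite addrK => /(pmaxC hO) h2.
  by rewrite h2 eqxx in l0.
elim: k r => [|k IH] r hr.
  exists 0; first by left.
  by rewrite expr0 divr1 addr0 {1}(size1_polyC hr) pevC.
have [r' hr' hs] := poly_XsubC_div r 0; rewrite subr0 in hr'.
have sr' : (sz r' <= k.+1)%N by move: hr hs; clear; lia.
have [u hu e] := IH _ sr'.
exists (u + iota r.[0] * y^-1 ^+ k.+1).
  apply: (pmaxD hO hu); rewrite mulrC exprS -mulrA; apply: (pmaxM hO hm).
  by apply: (placeM hO); [apply: (placeX hO); apply: (pmaxO hO)|apply: (placeC hO)].
have -> : r`_k.+1 = r'`_k by rewrite hr' coefD coefC coefXM addr0.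
rewrite addrA -e {1}hr' rmorphD rmorphM /= pevX pevC exprS exprVn exprS.
by field; rewrite expf_neq0 ?y_neq0.
Qed.

(** The equation gives [x^3 / y^p = (1 - y^-(p-1)) / (1 + a x^-2)], and the last denominator is a
    unit since [x] is a pole. *)
Lemma inf_cube : O (x ^+ 3 / y ^+ p).
Proof.
have x0 := x_neq0; have y0 := y_neq0.
have hx : pmax O x^-1 by apply: pmax_inv; apply: inf_x.
have hm : pmax O y^-1 by apply: pmax_inv.
pose u := 1 + iota a * x^-1 ^+ 2.
have hu : O u^-1.
  rewrite /u -(rmorph1 iota); apply: (place_unitD hO) => //; first exact: oner_neq0.
  rewrite mulrC expr2 -mulrA; apply: (pmaxM hO) => //.
  by apply: (placeM hO) => //; [apply: (pmaxO hO)|apply: (placeC hO)].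
have u0 : u != 0.
  apply/eqP => h; have : pmax O (u - iota a * x^-1 ^+ 2).
    apply: (pmaxB hO); first by left.
    rewrite mulrC expr2 -mulrA; apply: (pmaxM hO) => //.
    by apply: (placeM hO) => //; [apply: (pmaxO hO)|apply: (placeC hO)].
  by rewrite /u addrK -(rmorph1 iota) => /(pmaxC hO)/eqP; rewrite oner_eq0.
have e : x ^+ 3 / y ^+ p = (1 - y^-1 ^+ p.-1) * u^-1.
  have e1 : x ^+ 3 * u = y ^+ p - y by rewrite hxy /u; field.
  have e2 : y ^+ p = y ^+ p.-1 * y by rewrite -exprSr prednK // prime_gt0.
  apply: (mulIf u0); rewrite -[RHS]mulrA mulVf // mulr1 mulrAC e1 e2 exprVn.
  by field; rewrite y0 expf_neq0.
rewrite e; apply: (placeM hO) => //; apply: (placeB hO) => //; first exact: place1 hO.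
by apply: (placeX hO) => //; apply: (pmaxO hO).
Qed.

Lemma inf_yX (k : nat) : O (y^-1 ^+ k).
Proof. by apply: (placeX hO) => //; apply: (placeV hO). Qed.

(* The cube of [y^i x^j] is, up to a unit, a power of [y]. *)
Lemma inf_term q r j : q != 0 -> (bdd r (j * p) (3 * (sz q).-1)) ->
  O (ev r * x ^+ j / ev q).
Proof.
move=> q0; have y0 := y_neq0.
have [->|r0] := eqVneq r 0; first by move=> _; rewrite rmorph0 !mul0r;
  apply: (place0 hO).
rewrite /bdd (negPf r0) /= => h.
have [h1 _] := inf_poly r0.
have [h2 h3] := inf_poly q0; have h4 := pmax_unit h2 h3.
have e : ev r * x ^+ j / ev q = (ev r / y ^+ (sz r).-1) * (ev q / y ^+ (sz q).-1)^-1
   * (x ^+ j * y ^+ (sz r).-1 / y ^+ (sz q).-1).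
  by field; rewrite !expf_neq0 //= ev_eq0 q0.
rewrite e; apply: (placeM hO); first exact: (placeM hO).
apply: (place_root hO (k := 2)).
have [i hi] : exists i, (3 * (sz q).-1 = 3 * (sz r).-1 + j * p + i)%N.
  by exists (3 * (sz q).-1 - (3 * (sz r).-1 + j * p))%N; move: (sz_gt0 r); rewrite r0;
    clear -h; lia.
have -> : (x ^+ j * y ^+ (sz r).-1 / y ^+ (sz q).-1) ^+ 3 =
   (x ^+ 3 / y ^+ p) ^+ j * y^-1 ^+ i.
  rewrite !exprMn !exprVn -!exprM ![(_ * 3)%N]mulnC hi !exprD [(p * j)%N]mulnC.
  by field; rewrite !expf_neq0.
by apply: (placeM hO); [apply: (placeX hO); apply: inf_cube|apply: inf_yX].
Qed.

Lemma inf_unique z : O z <-> ord_le z 0.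
Proof.
have nleO u : ord_le u 0 -> O u.
  have [r [q [q0 hr]]] := frac_poly_rep u.
  have Q0 : ev q != 0 by rewrite ev_eq0.
  have hq : ord_le (ev q) (3 * (sz q).-1)%N%:Z.
    rewrite -(tev_poly iota x y); apply/ord_le_tev;
      rewrite /tbdd /= !bdd0 /bdd (negPf q0) /=.
    by rewrite andbT; move: (sz_gt0 q); rewrite q0; clear; lia.
  move=> hu; have := ord_leM hu hq; rewrite hr add0r => /ord_le_tev.
  case: r hr => [[A B] C] hr /and3P[hA hB hC]; rewrite /= in hA hB hC.
  have -> : u = ev A * x ^+ 0 / ev q + ev B * x ^+ 1 / ev q + ev C * x ^+ 2 / ev q.
    by apply: (mulIf Q0); rewrite hr /tev /=; field.
  by apply: (placeD hO); [apply: (placeD hO)|]; apply: inf_term => //;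
    rewrite ?mul0n ?mul1n.
split; last exact: nleO.
move=> hz; have [h|h] := lerP (n z) 0; first by right.
have [->|z0] := eqVneq z 0; first by left.
(* If [z] has a pole at infinity, then [z^3] has order at least 3, the order of [y]; so [y / z^3]
   lies in [O], and [z] in [O] would force [y] into [O]. *)
case: hy; have -> : y = z ^+ 3 * (y / z ^+ 3) by field.
apply: (placeM hO) => //; first exact: (placeX hO).
apply: nleO; right.
rewrite ord_infM ?invr_eq0 ?expf_neq0 ?y_neq0 // ord_infV ?expf_neq0 // ord_infX //
  ord_inf_y.
by clear -h; lia.
Qed.
End AtInfinity.

(** * Local rings of the affine curve *)

Lemma frobenius_sub (F : comNzRingType) (u v : F) :
  p \in [pchar F] -> (u - v) ^+ p = u ^+ p - v ^+ p.
Proof.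
move=> hF; have podd : odd p.
  by have [h2|//] := even_prime hp; move: hp4; rewrite h2.
rewrite exprDn_pchar; last by rewrite pnatE.
by rewrite exprNn -signr_odd podd mulN1r.
Qed.

Lemma pchar_L : p \in [pchar L].
Proof. exact: rmorph_pchar hpK. Qed.

Definition on_curve (x0 y0 : K) := y0 ^+ p - y0 = x0 ^+ 3 + a * x0.

Definition local_unit (y0 : K) : {poly K} := 1 - ('X - y0%:P) ^+ p.-1.

(** Subtract the equation at [(x0, y0)] from the one at [(x, y)] and use the additivity of
    Frobenius. As [local_unit y0] is 1 at [y0], this makes [x - x0] divide [y - y0] locally. *)
Lemma fiber_poly x0 y0 : on_curve x0 y0 ->
  (x - iota x0) * (x ^+ 2 + iota x0 * x + iota (x0 ^+ 2 + a)) =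
  - (ev (local_unit y0) * (y - iota y0)).
Proof.
move=> h.
have -> : ev (local_unit y0) = 1 - (y - iota y0) ^+ p.-1.
  by rewrite /local_unit rmorphB rmorph1 rmorphXn rmorphB /= pevX pevC.
rewrite [(1 - _) * _]mulrBl mul1r -exprSr prednK ?prime_gt0 // frobenius_sub ?pchar_L
  //.
have h' : iota y0 ^+ p - iota y0 = iota x0 ^+ 3 + iota a * iota x0.
  by rewrite -!rmorphXn -rmorphB h rmorphD rmorphXn rmorphM.
have -> : - (y - iota y0 - (y ^+ p - iota y0 ^+ p)) =
   (y ^+ p - y) - (iota y0 ^+ p - iota y0) by ring.
by rewrite hxy h'; ring.
Qed.

Definition local_ring (x0 y0 : K) (z : L) : Prop :=
  exists r s : triple K, tev idfun x0 y0 s != 0 /\ z * E s = E r.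

Section AtPoint.
Variables (x0 y0 : K).
Hypothesis hQ : on_curve x0 y0.
Notation eQ := (tev idfun x0 y0).
Notation O := (local_ring x0 y0).
Notation t := (x - iota x0).
Notation U := (local_unit y0).

Lemma local_tevM r s : eQ (tmul a p r s) = eQ r * eQ s.
Proof. exact: tevM. Qed.

Lemma local_tev_poly q : eQ (q, 0, 0) = q.[y0].
Proof.
by rewrite tev_poly /pev /horner_morph map_poly_id.
Qed.

Lemma local_tev r : O (E r).
Proof.
exists r, (1, 0, 0); rewrite local_tev_poly hornerC oner_eq0.
by rewrite tev_poly rmorph1 mulr1.
Qed.

Lemma local_ev q : O (ev q).
Proof. by rewrite -(tev_poly iota x); apply: local_tev. Qed.

Lemma local_tevV r : eQ r != 0 -> O (E r)^-1.
Proof.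
move=> h; exists (1, 0, 0), r; rewrite tev_poly rmorph1; split=> //.
rewrite mulVf // tev_eq0; apply: contra h => /eqP->.
by rewrite local_tev_poly horner0.
Qed.

Lemma localM u v : O u -> O v -> O (u * v).
Proof.
move=> [r [s [s0 h]]] [r' [s' [s'0 h']]].
exists (tmul a p r r'), (tmul a p s s'); rewrite local_tevM mulf_neq0 //; split=> //.
by rewrite !(tevM hxy) -h -h'; ring.
Qed.

Lemma localX u k : O u -> O (u ^+ k).
Proof.
move=> hu; elim: k => [|k IH]; last by rewrite exprS; apply: localM.
by rewrite expr0 -(rmorph1 ev); apply: local_ev.
Qed.

Lemma local_unit_horner : U.[y0] = 1.
Proof.
rewrite /local_unit !hornerE subrr expr0n.
have -> : (p.-1 == 0)%N = false by apply/negbTE; move: hp4; clear; lia.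
by rewrite subr0.
Qed.

Lemma local_unitV : O (ev U)^-1.
Proof.
rewrite -(tev_poly iota x); apply: local_tevV.
by rewrite local_tev_poly local_unit_horner oner_eq0.
Qed.

Definition param : triple K := ((- x0)%:P, 1, 0).

Lemma tev_param : E param = t.
Proof. by rewrite /tev /= pevC rmorph1 rmorph0 rmorphN; ring. Qed.

Lemma local_tev_param : eQ param = 0.
Proof. by rewrite /tev /= pevC rmorph1 rmorph0 /=; ring. Qed.

Lemma tnorm_param_root : (N param).[y0] = 0.
Proof.
have -> : N param = cpoly K p - (x0 ^+ 3 + a * x0)%:P.
  rewrite /tnorm /param rmorphD rmorphXn rmorphM rmorphN /=.
  by move: (cpoly _ _) => c; ring.
by rewrite -hQ /cpoly !hornerE subrr.
Qed.

Lemma param_neq0 : t != 0.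
Proof.
by rewrite -tev_param tev_eq0; apply/eqP => -[_ /eqP]; rewrite oner_eq0.
Qed.

(** Expand [r] in [y - y0]: the constant part is a polynomial in [x] with root [x0], and in the rest
    [U (y - y0)] is a multiple of [x - x0] by [fiber_poly]. *)
Lemma local_descent r : eQ r = 0 -> exists r1, tscale U r = tmul a p param r1.
Proof.
case: r => [[A B] C] h.
have [A1 hA _] := poly_XsubC_div A y0; have [B1 hB _] := poly_XsubC_div B y0.
have [C1 hC _] := poly_XsubC_div C y0.
move: h hA hB hC; rewrite /tev /= /pev /horner_morph !map_poly_id //.
move: A.[y0] B.[y0] C.[y0] => al be ga h hA hB hC.
(* The first summand is [U] times the quotient of [be (x - x0) + ga (x^2 - x0^2)] by [x - x0]; the
   second comes from [fiber_poly], with its sign. *)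
have [r1 hr1] : exists r1, r1 = tadd (tscale U ((be + ga * x0)%:P, ga%:P, 0))
  (topp (tmul a p ((x0 ^+ 2 + a)%:P, x0%:P, 1) (A1, B1, C1))) by eexists.
suff he : E (tscale U (A, B, C)) = E (tmul a p param r1) by exists r1;
  apply: tev_inj he.
rewrite (tevM hxy _ r1) tev_param hr1 tevD tevN (tevM hxy) !tev_scale.
have e1 : E (A, B, C) = iota al + iota be * x + iota ga * x ^+ 2 +
    (y - iota y0) * E (A1, B1, C1).
  rewrite /tev /= hA hB hC !rmorphD !rmorphM rmorphB /= !pevC pevX; ring.
have e2 : iota al = - iota be * iota x0 - iota ga * iota x0 ^+ 2.
  rewrite -rmorphXn -!rmorphN -!rmorphM -rmorphB; congr (iota _).
  by apply/eqP; rewrite -subr_eq0 -h; apply/eqP; ring.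
have e3 : E ((be + ga * x0)%:P, ga%:P, 0) = iota be + iota ga * (x + iota x0).
  by rewrite /tev /= !pevC rmorph0 rmorphD rmorphM; ring.
have e4 : E ((x0 ^+ 2 + a)%:P, x0%:P, 1) = x ^+ 2 + iota x0 * x + iota (x0 ^+ 2 + a).
  by rewrite /tev /= !pevC rmorph1; ring.
rewrite e1 e3 e4 e2 [RHS]mulrBr [X in _ = _ - X]mulrA (fiber_poly hQ).
ring.
Qed.

(** Iterate [local_descent]. It stops because each step lowers the multiplicity of [y0] in the norm:
    the norm of [param] vanishes at [y0], while [U] does not. *)
Lemma local_factor r : r != (0, 0, 0) -> exists k r', eQ r' != 0 /\
  ev U ^+ k * E r = t ^+ k * E r'.
Proof.
have [m hm] : exists m, (mup y0 (N r) < m)%N by exists (mup y0 (N r)).+1.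
elim: m r hm => // m IH r hm r0.
have [/eqP h|h] := boolP (eQ r == 0); last by exists 0%N, r; rewrite !expr0 !mul1r.
have [r1 hr1] := local_descent h.
have U0 : U != 0.
  by apply/eqP => h'; have := local_unit_horner; rewrite h' horner0 => /esym/eqP;
    rewrite oner_eq0.
have r10 : r1 != (0, 0, 0).
  rewrite -tev_eq0; have := congr1 E hr1; rewrite tev_scale (tevM hxy) => h'.
  apply: contra r0 => /eqP h''; rewrite h'' mulr0 in h'.
  by move/eqP: h'; rewrite mulf_eq0 ev_eq0 (negPf U0) tev_eq0.
have N0 s : s != (0, 0, 0) -> N s != 0 by rewrite (tnorm_eq0 a p_gt1 p_mod3).
have hlt : (mup y0 (N r1) < m)%N.
  have := congr1 (fun s => mup y0 (N s)) hr1.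
  rewrite tnorm_scale tnormM mupMr; last first.
    by rewrite /root horner_exp local_unit_horner expr1n oner_eq0.
  have param0 : param != (0, 0, 0) by rewrite -tev_eq0 tev_param param_neq0.
  rewrite mupM ?N0 //.
  have : (0 < mup y0 (N param))%N by rewrite -XsubC_dvd ?N0 // dvdp_XsubCl /root
    tnorm_param_root.
  by move: hm; clear; lia.
have [k [r' [hr' e]]] := IH _ hlt r10.
exists k.+1, r'; split=> //.
have e' : ev U * E r = t * E r1 by rewrite -tev_scale hr1 (tevM hxy) tev_param.
by rewrite exprSr -mulrA e' mulrCA e exprS mulrA.
Qed.

(** By [local_factor], numerator and denominator are powers of [t] times units; comparing the
    exponents puts the fraction or its inverse in the ring. *)
Lemma local_place : is_place iota O.
Proof.
have ad u v : O u -> O v -> O (u + v).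
  move=> [r [s [s0 h]]] [r' [s' [s'0 h']]].
  exists (tadd (tmul a p r s') (tmul a p r' s)), (tmul a p s s').
  by rewrite local_tevM mulf_neq0 //; split=> //; rewrite tevD !(tevM hxy) -h -h'; ring.
split.
- by move=> c; rewrite -(pevC iota y); apply: local_ev.
- split=> // u [r [s [s0 h]]]; exists (topp r), s; split=> //.
  by rewrite tevN mulNr h.
- exact: localM.
- exists t^-1 => -[r [s [/eqP s0 h]]]; apply: s0.
  have -> : s = tmul a p param r.
    by apply: tev_inj; rewrite (tevM hxy) tev_param -h mulVKf // param_neq0.
  by rewrite local_tevM local_tev_param mul0r.
- move=> z z0; have [r [s [r0 s0 h]]] := frac_rep z0.
  have [k [r' [r'0 e]]] := local_factor r0.
  have [l [s' [s'0 e']]] := local_factor s0.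
  have Ot : O t by rewrite -tev_param; apply: local_tev.
  have Es0 : E s != 0 by rewrite tev_eq0.
  have Er0 : E r != 0 by rewrite tev_eq0.
  have nz r1 : eQ r1 != 0 -> E r1 != 0.
    by move=> h1; rewrite tev_eq0; apply: contra h1 => /eqP->;
      rewrite local_tev_poly horner0.
  have Es'0 := nz _ s'0; have Er'0 := nz _ r'0.
  have U0 : ev U != 0.
    have := local_unit_horner; rewrite ev_eq0 => h1; apply/eqP => h2.
    by move: h1; rewrite h2 horner0 => /esym/eqP; rewrite oner_eq0.
  have t0 := param_neq0.
  have er : E r = t ^+ k * E r' / ev U ^+ k by rewrite -e mulrC mulKf ?expf_neq0.
  have es : E s = t ^+ l * E s' / ev U ^+ l by rewrite -e' mulrC mulKf ?expf_neq0.
  have ez : z = E r / E s by rewrite -h mulfK.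
  have aux (i j : nat) r1 s1 : eQ s1 != 0 -> (i <= j)%N ->
      O (t ^+ j * E r1 / ev U ^+ j / (t ^+ i * E s1 / ev U ^+ i)).
    move=> h1 hij; have h1' := nz _ h1.
    have -> : t ^+ j * E r1 / ev U ^+ j / (t ^+ i * E s1 / ev U ^+ i) =
       t ^+ (j - i) * E r1 * (ev U)^-1 ^+ j * ev U ^+ i * (E s1)^-1.
      rewrite -{1}(subnK hij) exprD exprVn; field.
      by rewrite h1' !expf_neq0.
    have h2 := local_unitV; have h3 := local_tevV h1; have h4 := local_ev U.
    by do ![apply: localM | apply: localX]; rewrite ?local_tev //; apply: local_tev.
  have [hkl|/ltnW hkl] := leqP l k; first by left; rewrite ez er es; apply: aux.
  by right; rewrite ez invfM invrK mulrC er es; apply: aux.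
Qed.

Lemma local_pmaxE r : pmax O (E r) <-> eQ r = 0.
Proof.
have aux s : eQ s = 0 -> pmax O (E s).
  move=> h; have [->|Es0] := eqVneq (E s) 0; [by left|right].
  move=> [r' [s' [/eqP s'0 h']]]; apply: s'0.
  have -> : s' = tmul a p s r' by apply: tev_inj; rewrite (tevM hxy) -h' mulVKf.
  by rewrite local_tevM h mul0r.
split=> [h|]; last exact: aux.
have : pmax O (E (tadd r (topp ((eQ r)%:P, 0, 0)))).
  by apply: aux; rewrite tevD tevN local_tev_poly hornerC subrr.
rewrite tevD tevN tev_poly pevC => h'.
have := pmaxB local_place h h'; rewrite opprB addrC subrK.
exact: pmaxC local_place _.
Qed.

Lemma pmax_t : pmax O t.
Proof. by rewrite -tev_param; apply/local_pmaxE/local_tev_param. Qed.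

Lemma pmax_y : pmax O (y - iota y0).
Proof.
have -> : y - iota y0 = E ('X - y0%:P, 0, 0) by rewrite tev_poly rmorphB /= pevX pevC.
by apply/local_pmaxE; rewrite local_tev_poly hornerXsubC subrr.
Qed.

Lemma local_x : O x.
Proof.
have -> : x = t + iota x0 by rewrite subrK.
by apply: (placeD local_place);
  [apply: (pmaxO local_place pmax_t) | apply: placeC local_place _].
Qed.

Lemma local_pevx q : O (pev iota x q).
Proof.
elim/poly_ind: q => [|q c IH]; first by rewrite rmorph0; apply: place0 local_place.
rewrite rmorphD rmorphM /= pevX pevC; apply: (placeD local_place).
  by apply: localM => //; apply: local_x.
exact: placeC local_place _.
Qed.
End AtPoint.

Lemma pevx_eq0 q : (pev iota x q == 0) = (q == 0).
Proof. by apply/eqP/eqP => [/htr|->] //; rewrite rmorph0. Qed.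

(** A proper fraction [h / s] in [x] that is regular at every zero of [s] must vanish. At a root
    [x1] of [s], regularity forces [h] to vanish as well; cancelling [X - x1] keeps the fraction and
    lowers the degree of [s]. *)
Lemma local_vanish (y0 : K) (s h : {poly K}) :
  (sz h < sz s)%N ->
  (forall x1, root s x1 -> on_curve x1 y0 /\
     local_ring x1 y0 (pev iota x h / pev iota x s)) -> h = 0.
Proof.
have [m hm] : exists m, (sz s <= m)%N by exists (sz s).
elim: m s h hm => [|m IH] s h hm hs H; first by move: hm hs; clear; lia.
have s0 : s != 0 by rewrite -sz_gt0; move: hs; clear; lia.
have [/eqP h1|h1] := boolP (sz s == 1%N).
  by apply/eqP; rewrite -[_ == _]negbK -sz_gt0; move: hs; rewrite h1; clear; lia.
have [x1 rx1] := closed_rootP s h1.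
have [hQ Ox] := H _ rx1.
have hP := local_place hQ.
have [s1 es _] := poly_XsubC_div s x1; have [h2 eh _] := poly_XsubC_div h x1.
rewrite (eqP rx1) addr0 in es.
have ms : pmax (local_ring x1 y0) (pev iota x s).
  rewrite es rmorphM rmorphB /= pevX pevC; apply: (pmaxM hP); first exact: pmax_t.
  exact: local_pevx.
have mh : pmax (local_ring x1 y0) (pev iota x h).
  rewrite -[pev iota x h](divfK (x := pev iota x s)) ?pevx_eq0 // mulrC.
  exact: (pmaxM hP).
have hx : h.[x1] = 0.
  apply: (pmaxC hP); have -> : iota h.[x1] = pev iota x h - (x - iota x1) * pev iota x
    h2.
    by rewrite {2}eh rmorphD rmorphM rmorphB /= pevX !pevC addrC addKr.
  apply: (pmaxB hP) => //; apply: (pmaxM hP); first exact: pmax_t.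
  exact: local_pevx.
rewrite hx addr0 in eh.
have s10 : s1 != 0 by apply: contra s0 => /eqP h'; rewrite es h' mulr0.
rewrite eh (IH s1 h2) ?mulr0 //.
- by move: hm; rewrite es szM ?polyXsubC_eq0 // {1}/sz size_XsubC; clear; lia.
- have [->|h20] := eqVneq h2 0; first by rewrite {1}/sz size_poly0 sz_gt0.
  move: hs; rewrite es eh !szM ?polyXsubC_eq0 // !{1}[sz ('X - _)]/sz size_XsubC.
  by clear; lia.
- move=> x2 rx2; have rx2' : root s x2 by rewrite es rootM rx2 orbT.
  have [hQ2 Ox2] := H _ rx2'; split=> //; move: Ox2.
  rewrite es eh !rmorphM /= -mulf_div divff ?mul1r //.
  by rewrite pevx_eq0 polyXsubC_eq0.
Qed.

Definition fiber (y0 : K) : {poly K} := 'X^3 + a *: 'X - (y0 ^+ p - y0)%:P.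

Lemma sz_fiber y0 : sz (fiber y0) = 4%N.
Proof.
rewrite /fiber /sz -addrA size_polyDl ?size_polyXn // -mul_polyC -polyCN size_MXaddC.
by case: ifP => // _; rewrite ltnS (leq_ltn_trans (size_polyC_leq1 a)).
Qed.

Lemma fiber_root y0 x0 : root (fiber y0) x0 <-> on_curve x0 y0.
Proof.
rewrite /root /fiber !hornerE subr_eq0 /on_curve; split=> [/eqP->|->] //.
Qed.

Lemma ev_fiber y0 : pev iota x (fiber y0) = - (ev (local_unit y0) * (y - iota y0)).
Proof.
have [x0 /fiber_root h] : exists x0, root (fiber y0) x0.
  by apply: closed_rootP; rewrite -/(sz _) sz_fiber.
rewrite -(fiber_poly h) /fiber h -mul_polyC !rmorphB !rmorphD /= rmorphXn /= !rmorphM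
  /= pevX !pevC.
by rewrite ?rmorphD ?rmorphXn /= ?rmorphM /=; ring.
Qed.

Lemma ev_unit_neq0 y0 : ev (local_unit y0) != 0.
Proof.
rewrite ev_eq0; apply/eqP => h; have := local_unit_horner y0.
by rewrite h horner0 => /esym/eqP; rewrite oner_eq0.
Qed.

(** Remove the roots [y0] of the denominator one by one: the part of the numerator constant in
    [y - y0] has degree at most 2 in [x], and its quotient by the cubic [fiber y0] is regular over
    [y0], so [local_vanish] kills it. *)
Lemma regular_everywhere f :
  (forall x0 y0, on_curve x0 y0 -> local_ring x0 y0 f) -> exists r, f = E r.
Proof.
move=> H; have [r [q [q0 hr]]] := frac_poly_rep f.
have [m hm] : exists m, (sz q <= m)%N by exists (sz q).
elim: m q r hm q0 hr => [|m IH] q r hm q0 hr.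
  by move: hm q0; rewrite -sz_gt0; clear; lia.
have [/eqP/eqP/size_poly1P[c c0 hq]|h1] := boolP (sz q == 1%N).
  exists (tscale (c^-1)%:P r); rewrite tev_scale -hr hq !pevC mulrCA -rmorphM.
  by rewrite mulVf // rmorph1 mulr1.
have [y0 ry0] := closed_rootP q h1.
have [q1 eq1 sq1] := poly_XsubC_div q y0; rewrite (eqP ry0) addr0 in eq1.
case: r hr => [[A B] C] hr.
have [A1 hA _] := poly_XsubC_div A y0; have [B1 hB _] := poly_XsubC_div B y0.
have [C1 hC _] := poly_XsubC_div C y0.
move: hA hB hC; move: A.[y0] B.[y0] C.[y0] => al be ga hA hB hC.
have e1 : E (A, B, C) = pev iota x (ga *: 'X^2 + be *: 'X + al%:P) +
    (y - iota y0) * E (A1, B1, C1).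
  rewrite /tev /= hA hB hC -!mul_polyC !rmorphD /= !rmorphM /= ?rmorphB /= !pevC
    ?rmorphXn /= !pevX.
  by ring.
have Y0 := y_subC_neq0 y0.
have eq1' : ev q = (y - iota y0) * ev q1 by rewrite eq1 rmorphM rmorphB /= pevX pevC.
have h0 : ga *: 'X^2 + be *: 'X + al%:P = 0 :> {poly K}.
  apply: (@local_vanish y0 (fiber y0)).
    rewrite sz_fiber; apply: (@leq_ltn_trans 3) => //.
    apply/leq_sizeP => i hi; rewrite !coefE.
    by case: i hi => [|[|[|i]]] //= _; rewrite !mulr0 !addr0.
  move=> x1 /fiber_root hQ; split=> //; have hP := local_place hQ.
  have -> : pev iota x (ga *: 'X^2 + be *: 'X + al%:P) / pev iota x (fiber y0) =
     - ((f * ev q1 - E (A1, B1, C1)) * (ev (local_unit y0))^-1).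
    have -> : pev iota x (ga *: 'X^2 + be *: 'X + al%:P) =
       (y - iota y0) * (f * ev q1 - E (A1, B1, C1)).
      by rewrite mulrBr mulrCA -eq1' hr e1 addrK.
    rewrite ev_fiber; field.
    by rewrite ?Y0 ?ev_unit_neq0 ?andbT /= ?oppr_eq0 ?mulf_neq0 ?ev_unit_neq0.
  apply: (placeN hP); apply: (placeM hP); last exact: local_unitV.
  apply: (placeB hP); last exact: local_tev.
  by apply: (placeM hP); [apply: H|apply: local_ev].
apply: (IH q1 (A1, B1, C1)).
- by move: hm sq1; clear; lia.
- by apply: contra q0 => /eqP h'; rewrite eq1 h' mulr0.
- by apply: (mulfI Y0); rewrite mulrCA -eq1' hr e1 h0 rmorph0 add0r.
Qed.

(** * Automorphisms *)

(** If [u] were constant, so would be [v] by the equation, and then all of [L], including [x]. *)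
Lemma generates_transc u v : generates iota u v ->
  v ^+ p - v = u ^+ 3 + iota a * u -> transcendental iota u.
Proof.
move=> huv hrel q hq; apply/eqP; apply: contrapT => /negP q0.
have [c hc _] := closed_root q0 hq.
have [d hd] : exists d, v = iota d.
  pose k := c ^+ 3 + a * c.
  have h0 : 'X^p - 'X - k%:P != 0 :> {poly K}.
    by rewrite -size_poly_gt0 -addrA size_polyDl ?size_polyXn // -opprD size_polyN
      size_XaddC ltnS p_gt1.
  have [|d -> _] := closed_root (v := v) (j := iota) h0; last by exists d.
  have -> : pev iota v ('X^p - 'X - k%:P) = v ^+ p - v - iota k.
    by rewrite -(pev_cpoly p iota v) -(pevC iota v k) -rmorphB.
  by rewrite hrel hc /k rmorphD rmorphXn rmorphM; ring.
have [e he] : exists e, x = iota e.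
  apply: (huv (fun z => exists e, z = iota e)).
  - by move=> e; exists e.
  - by exists c.
  - by exists d.
  - by move=> _ _ [e ->] [e' ->]; exists (e + e'); rewrite rmorphD.
  - by move=> _ [e ->]; exists (- e); rewrite rmorphN.
  - by move=> _ _ [e ->] [e' ->]; exists (e * e'); rewrite rmorphM.
  - by move=> _ [e ->]; exists e^-1; rewrite fmorphV.
have /htr/eqP : (map_poly iota ('X - e%:P)).[x] = 0.
  by rewrite rmorphB /= map_polyX map_polyC !hornerE he subrr.
by rewrite polyXsubC_eq0.
Qed.

(** Substituting [(u, v)] in fractions [E r / q(y)] is well defined because both pairs satisfy the
    same equation and [v] is transcendental; the image is everything because [u] and [v]
    generate. *)
Lemma Kaut_exists u v : generates iota u v ->
  v ^+ p - v = u ^+ 3 + iota a * u ->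
  exists f, [/\ is_Kaut iota f, f x = u & f y = v].
Proof.
move=> huv hrel; have utr := generates_transc huv hrel.
have ev0 q : q != 0 -> pev iota v q != 0.
  by apply: contra => /eqP/(rel_transc utr hrel)->.
pose E' := tev iota u v; pose ev' := pev iota v.
have hex z : exists w, forall r q, q != 0 -> z * ev q = E r -> w * ev' q = E' r.
  have [r0 [q0 [q00 h0]]] := frac_poly_rep z; exists (E' r0 / ev' q0) => r q q_0 h.
  have : tscale q r0 = tscale q0 r.
    by apply: tev_inj; rewrite (tev_scale _ _ _ q) (tev_scale _ _ _ q0) -h0 -h; ring.
  move/(congr1 E'); rewrite /E' (tev_scale _ _ _ q) (tev_scale _ _ _ q0) => e.
  by apply: (mulfI (ev0 _ q00)); rewrite -e mulrA mulrCA divff ?ev0 // mulr1 mulrC.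
have [f hf] := choice hex.
have fE z w : (exists r q, [/\ q != 0, z * ev q = E r & w * ev' q = E' r]) -> f z = w.
  by move=> [r [q [q0 h1 h2]]]; apply: (mulIf (ev0 _ q0)); rewrite h2; apply: hf.
have rep z : exists r q, [/\ q != 0, z * ev q = E r & f z * ev' q = E' r].
  by have [r [q [q0 h]]] := frac_poly_rep z; exists r, q; split=> //; apply: hf.
have fD b c : f (b + c) = f b + f c.
  have [r [q [q0 h1 h2]]] := rep b; have [s [q' [q'0 h3 h4]]] := rep c.
  apply: fE; exists (tadd (tscale q' r) (tscale q s)), (q * q').
  rewrite /E' !tevD !tev_scale -h1 -h3 -[tev _ _ _ r]h2 -[tev _ _ _ s]h4 mulf_neq0 //.
  by rewrite /ev' !rmorphM /=; split=> //; ring.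
have fM b c : f (b * c) = f b * f c.
  have [r [q [q0 h1 h2]]] := rep b; have [s [q' [q'0 h3 h4]]] := rep c.
  apply: fE; exists (tmul a p r s), (q * q').
  rewrite /E' (tevM hxy) (tevM hrel) -h1 -h3 -[tev _ _ _ r]h2 -[tev _ _ _ s]h4
    mulf_neq0 //.
  by rewrite /ev' !rmorphM /=; split=> //; ring.
have fC c : f (iota c) = iota c.
  apply: fE; exists (c%:P, 0, 0), 1.
  by rewrite oner_eq0 /E' /ev' !tev_poly !pevC !rmorph1 !mulr1.
have f1 : f 1 = 1 by rewrite -(rmorph1 iota) fC.
have f0 : f 0 = 0 by rewrite -(rmorph0 iota) fC.
have fx : f x = u.
  apply: fE; exists (0, 1, 0), 1.
  by rewrite oner_eq0 /E' /ev' /tev /= !rmorph1 !rmorph0; split=> //; ring.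
have fy : f y = v.
  apply: fE; exists ('X, 0, 0), 1.
  by rewrite oner_eq0 /E' /ev' !tev_poly !pevX !rmorph1 !mulr1.
have fN b : f (- b) = - f b by apply/eqP; rewrite -addr_eq0 -fD addrC subrr f0.
have fn0 b : b != 0 -> f b != 0.
  move=> b0; apply/eqP => h; have : f (b * b^-1) = 0 by rewrite fM h mul0r.
  by rewrite divff // f1 => /eqP; rewrite oner_eq0.
have finj : injective f.
  move=> b c h; apply/eqP; rewrite -subr_eq0; apply: contrapT => /negP/fn0.
  by rewrite fD fN h subrr eqxx.
have fsurj z : exists w, f w = z.
  apply: (huv (fun z => exists w, f w = z)).
  - by move=> c; exists (iota c).
  - by exists x.
  - by exists y.
  - by move=> _ _ [b <-] [c <-]; exists (b + c).
  - by move=> _ [b <-]; exists (- b).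
  - by move=> _ _ [b <-] [c <-]; exists (b * c).
  - move=> _ [b <-]; exists b^-1; have [->|b0] := eqVneq b 0;
    first by rewrite invr0 f0 invr0.
    by apply: (mulfI (fn0 _ b0)); rewrite -fM !divff ?fn0.
have [g hg] := choice fsurj.
exists f; split=> //; split=> //; exists g; split=> // z.
by apply: finj; rewrite hg.
Qed.

(** The automorphism and its inverse are packed as ring morphisms, so that morphism rewriting
    applies to both. *)
Definition aut_pair (F G : {rmorphism L -> L}) :=
  [/\ cancel F G, cancel G F & forall c, F (iota c) = iota c].

Lemma Kaut_rmorph f : is_Kaut iota f -> exists F G, aut_pair F G /\ F =1 f.
Proof.
move=> [[g [fg gf]] fD fM f1 fC].
have mk (h : L -> L) : (forall b c, h (b + c) = h b + h c) ->
    (forall b c, h (b * c) = h b * h c) -> h 1 = 1 ->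
    exists H : {rmorphism L -> L}, H =1 h.
  move=> hD hM h1; have h0 : h 0 = 0.
    by apply: (addrI (h 0)); rewrite -hD !addr0.
  have hB : {morph h : b c / b - c >-> b - c}.
    move=> b c; rewrite hD; congr (_ + _); apply/eqP.
    by rewrite -addr_eq0 -hD addrC subrr h0.
  pose ha := GRing.isZmodMorphism.Build L L h hB.
  pose hm := GRing.isMonoidMorphism.Build L L h (conj h1 hM).
  pose H : {rmorphism L -> L} := HB.pack h ha hm.
  by exists H.
have [F hF] := mk f fD fM f1.
have [|||G hG] := mk g.
- by move=> b c; rewrite -{1}(gf b) -{1}(gf c) -fD fg.
- by move=> b c; rewrite -{1}(gf b) -{1}(gf c) -fM fg.
- by rewrite -f1 fg.
exists F, G; split=> //; split=> z; rewrite ?hF ?hG //.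
Qed.

Lemma Kaut_ext f g : is_Kaut iota f -> is_Kaut iota g ->
  f x = g x -> f y = g y -> f = g.
Proof.
move=> /Kaut_rmorph[F [F' [[_ _ autC] hF]]] /Kaut_rmorph[G [G' [[_ _ autVC] hG]]].
rewrite -!hF -!hG => ex ey; apply: funext => z; rewrite -hF -hG.
apply: (hgen (S := fun z => F z = G z)) => //.
- by move=> c; rewrite autC autVC.
- by move=> b c h1 h2; rewrite !rmorphD /= h1 h2.
- by move=> b h1; rewrite !rmorphN /= h1.
- by move=> b c h1 h2; rewrite !rmorphM /= h1 h2.
- by move=> b h1; rewrite !fmorphV /= h1.
Qed.

Lemma aut_pair_Kaut F G : aut_pair F G -> is_Kaut iota F.
Proof.
move=> [autK autVK autC]; split=> //.
- by exists G.
- exact: rmorphD.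
- exact: rmorphM.
- exact: rmorph1.
Qed.

Lemma aut_pair_sym F G : aut_pair F G -> aut_pair G F.
Proof. by move=> [autK autVK autC]; split=> // c; rewrite -{1}autC autK. Qed.

Lemma aut_pair_comp F G F' G' : aut_pair F G -> aut_pair F' G' ->
  exists H H', aut_pair H H' /\ H =1 F \o F'.
Proof.
move=> [autK autVK autC] [F'K G'K F'C].
exists (GRing.RMorphism.clone _ _ (F \o F') _), (GRing.RMorphism.clone _ _ (G' \o G) _).
split=> //; split=> z /=; first by rewrite autK F'K.
  by rewrite G'K autVK.
by rewrite F'C autC.
Qed.

Lemma ord_inf_const c : c != 0 -> n (iota c) = 0.
Proof.
move=> c0; have c0' : iota c != 0 by rewrite fmorph_eq0.
have := ord_leC c; have := ord_leC c^-1; rewrite fmorphV => -[/eqP|h1].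
  by rewrite invr_eq0 (negPf c0').
case=> [/eqP|h2]; first by rewrite (negPf c0').
by move: h1 h2; rewrite ord_infV //; move: (n _) => k; clear; lia.
Qed.

(* 1 and 2 are gaps of the semigroup generated by 3 and [p]. *)
Lemma ord_le2_const r : ord_le (E r) 2 -> exists c, E r = iota c.
Proof.
move=> /(ord_le_tev r 2%N); case: r => [[A B] C] /and3P[/= hA hB hC].
have B0 : B = 0.
  apply/eqP; rewrite -[_ == _]negbK -sz_gt0; move: hB.
  by rewrite /bdd => /orP[/eqP->|]; [rewrite /sz size_poly0 | move: (sz B) hp4 => b;
    clear; lia].
have C0 : C = 0.
  apply/eqP; rewrite -[_ == _]negbK -sz_gt0; move: hC.
  by rewrite /bdd => /orP[/eqP->|]; [rewrite /sz size_poly0 | move: (sz C) hp4 => b;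
    clear; lia].
have sA : (sz A <= 1)%N.
  by move: hA; rewrite /bdd => /orP[/eqP->|];
    [rewrite /sz size_poly0 | move: (sz A) => b; clear; lia].
by exists A`_0; rewrite B0 C0 tev_poly {1}(size1_polyC sA) pevC.
Qed.

Section Automorphism.
Variables F G : {rmorphism L -> L}.
Hypothesis FG : aut_pair F G.

Lemma autK : cancel F G. Proof. by case: FG. Qed.
Lemma autVK : cancel G F. Proof. by case: FG. Qed.
Lemma autC c : F (iota c) = iota c. Proof. by case: FG. Qed.
Lemma autVC c : G (iota c) = iota c. Proof. by rewrite -{1}autC autK. Qed.

Lemma Fy_nonconst c : F y <> iota c.
Proof.
move=> h; have /eqP := y_subC_neq0 c; apply.
by rewrite -[y]autK h autVC subrr.
Qed.

(** The pullback of [O] by [F] is a place where [y] has a pole, hence the one at infinity. In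
    particular all places where [F y] has a pole coincide. *)
Lemma place_pole O : is_place iota O -> ~ O (F y) -> forall z, O z <-> ord_le (G z) 0.
Proof.
move=> hO hy z; have hO' := place_pull hO (aut_pair_Kaut FG).
by rewrite -(inf_unique hO' hy) autVK.
Qed.

Lemma pmax_pole O : is_place iota O -> ~ O (F y) ->
  forall u, pmax O u -> ord_le (G u) (-1).
Proof.
move=> hO hy u [->|h]; first by left; rewrite rmorph0.
have [->|u0] := eqVneq u 0; first by left; rewrite rmorph0.
have Gu0 : G u != 0 by rewrite fmorph_eq0.
right; have [//|h'] := lerP (n (G u)) (-1); case: h.
apply/(place_pole hO hy); right; rewrite fmorphV ord_infV //; move: h';
  move: (n _) => k; clear; lia.
Qed.

(** * Automorphisms for which [F y] has an affine pole *)

Section Pole.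
Variables x0 y0 : K.
Hypothesis hP : on_curve x0 y0.
Hypothesis hpole : ~ local_ring x0 y0 (F y).
Notation Y := (y - iota y0).
Notation t := (x - iota x0).

(** A second pole at infinity would identify the two places, but [y] is regular at only one of
    them. *)
Lemma Fy_inf : ord_le (F y) 0.
Proof.
apply: contrapT => h; have h1 := place_pole place_inf h.
have h2 := place_pole (local_place hP) hpole.
have : ord_le y 0.
  apply/h1; apply/h2; rewrite -(pevX iota y); exact: local_ev.
by case=> [/eqP|]; rewrite ?(negPf y_neq0) // ord_inf_y.
Qed.

(** The cofactor of [X - x0] in [fiber y0]. *)
Definition cofiber : {poly K} := 'X^2 + x0 *: 'X + (x0 ^+ 2 + a)%:P.

Lemma sz_cofiber : sz cofiber = 3%N.
Proof.
rewrite /cofiber /sz -addrA size_polyDl ?size_polyXn // -mul_polyC size_MXaddC.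
by case: ifP => // _; rewrite ltnS (leq_ltn_trans (size_polyC_leq1 x0)).
Qed.

Lemma cofiber_horner x1 : cofiber.[x1] = x1 ^+ 2 + x0 * x1 + (x0 ^+ 2 + a).
Proof. by rewrite /cofiber !hornerE. Qed.

Lemma pev_cofiber : pev iota x cofiber = x ^+ 2 + iota x0 * x + iota (x0 ^+ 2 + a).
Proof.
by rewrite /cofiber -mul_polyC !rmorphD /= !rmorphM /= !pevC !pevX; ring.
Qed.

Lemma cofiber_root x1 : root cofiber x1 -> on_curve x1 y0.
Proof.
rewrite /root cofiber_horner /on_curve hP => /eqP h.
apply/eqP; rewrite -subr_eq0; apply/eqP.
transitivity ((x0 - x1) * (x1 ^+ 2 + x0 * x1 + (x0 ^+ 2 + a))); first by ring.
by rewrite h mulr0.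
Qed.

Lemma ord_le_GY : ord_le (G Y) (-1).
Proof. by apply: (pmax_pole (local_place hP) hpole); apply: pmax_y. Qed.

(* [F y] has no pole at the points over [y0] other than those with the local ring of
   [(x0, y0)], so [cofiber] divides the part of [Y^(j+2) F y] constant in [Y], which
   has smaller degree. *)
Lemma pole_step (j : nat) A B : Y ^+ j.+2 * F y = E (A, B, 0) ->
  A.[y0] = 0 /\ B.[y0] = 0.
Proof.
move=> hE; have [A1 hA _] := poly_XsubC_div A y0; have [B1 hB _] := poly_XsubC_div B y0.
move: hA hB; move: A.[y0] B.[y0] => al be hA hB.
pose h : {poly K} := be *: 'X + al%:P.
have eh : pev iota x h = iota be * x + iota al.
  by rewrite /h -mul_polyC rmorphD rmorphM /= !pevC pevX.
have e1 : E (A, B, 0) = pev iota x h + Y * E (A1, B1, 0).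
  rewrite eh /tev /= hA hB !rmorphD !rmorphM rmorphB /= !rmorph0 !pevC pevX; ring.
suff h0 : h = 0.
  have := congr1 (fun q : {poly K} => q`_0) h0;
    have := congr1 (fun q : {poly K} => q`_1) h0.
  by rewrite !coefE /= mulr1 mulr0 addr0 add0r.
apply: (@local_vanish y0 cofiber).
  rewrite sz_cofiber; apply: (@leq_ltn_trans 2) => //.
  apply/leq_sizeP => i hi; rewrite !coefE.
  by case: i hi => [|[|i]] //= _; rewrite !mulr0 !addr0.
move=> x1 rx1; have hQ := cofiber_root rx1; split=> //.
have pP := local_place hP; have pQ := local_place hQ.
have hu : local_ring x1 y0 (ev (local_unit y0))^-1 by apply: local_unitV.
have Y0 := y_subC_neq0 y0; have u0 := ev_unit_neq0 y0.
have ts : t * pev iota x cofiber = - (ev (local_unit y0) * Y).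
  by rewrite pev_cofiber; apply: fiber_poly.
have s0 : pev iota x cofiber != 0 by rewrite pevx_eq0 -sz_gt0 sz_cofiber.
(* If [F y] is regular at [(x1, y0)], then so is the fraction, since [Y] is [- t cofiber(x)] divided
   by a unit. *)
have [hF|hF] := pselect (local_ring x1 y0 (F y)).
  have -> : pev iota x h / pev iota x cofiber =
     - (t * (ev (local_unit y0))^-1) * (Y ^+ j.+1 * F y - E (A1, B1, 0)).
    have -> : pev iota x h = Y * (Y ^+ j.+1 * F y - E (A1, B1, 0)).
      by rewrite mulrBr mulrA -exprS hE e1 addrK.
    have -> : Y = - (t * pev iota x cofiber) / ev (local_unit y0).
      by rewrite ts opprK mulrC mulKf.
    by field; rewrite s0 u0.
  have OY : local_ring x1 y0 Y.
    by rewrite -(pevX iota y) -(pevC iota y) -rmorphB; apply: local_ev.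
  have Ot : local_ring x1 y0 t.
    by apply: (placeB pQ); [exact: local_x|exact: (placeC pQ)].
  apply: (placeM pQ); first by apply: (placeN pQ); apply: (placeM pQ).
  apply: (placeB pQ); last exact: local_tev.
  by apply: (placeM pQ) => //; apply: (placeX pQ).
(* Otherwise [F y] has a pole at [(x1, y0)] too, possibly with [x1 = x0], and regularity there means
   order at most 0 at infinity after applying [G]. *)
have PP := place_pole pP hpole; have PQ := place_pole pQ hF; apply/PQ.
have nt : ord_le (G t) (-1) by apply: (pmax_pole pP hpole); apply: pmax_t.
have ns : ord_le (G (pev iota x cofiber)) (-1).
  apply: (pmax_pole pQ hF).
  have -> : pev iota x cofiber = E ((x0 ^+ 2 + a)%:P, x0%:P, 1).
    by rewrite pev_cofiber /tev /= !pevC rmorph1; ring.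
  apply/(local_pmaxE hQ); rewrite /tev /= !pevC rmorph1 /= mul1r.
  by move/eqP: rx1; rewrite cofiber_horner => <-; ring.
have t0 : t != 0 := param_neq0 x0.
have nu : n (G (ev (local_unit y0))) = 0.
  have n1' : ord_le (G (ev (local_unit y0))) 0 by apply/PQ/local_ev.
  have n2' : ord_le (G (ev (local_unit y0))^-1) 0 by apply/PQ.
  case: n1' => [/eqP|n1']; first by rewrite fmorph_eq0 (negPf u0).
  case: n2' => [/eqP|]; first by rewrite fmorph_eq0 invr_eq0 (negPf u0).
  by rewrite fmorphV ord_infV ?fmorph_eq0 //; move: n1'; move: (n _) => k; clear; lia.
have gs0 : G (pev iota x cofiber) != 0 by rewrite fmorph_eq0.
have gt0 : G t != 0 by rewrite fmorph_eq0.
have gY0 : G Y != 0 by rewrite fmorph_eq0.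
have gu0 : G (ev (local_unit y0)) != 0 by rewrite fmorph_eq0.
have nY : n (G Y) = n (G t) + n (G (pev iota x cofiber)).
  rewrite -ord_infM // -rmorphM ts rmorphN rmorphM -mulN1r ord_infM ?mulf_neq0
    ?oppr_eq0 ?oner_neq0 //.
  rewrite ord_infM // nu add0r.
  suff -> : n (-1) = 0 by rewrite add0r.
  have := @ord_infM (-1) (-1);
    rewrite mulrNN mulr1 ord_inf1 oppr_eq0 oner_eq0 => /(_ isT isT).
  by move: (n (-1)) => k; clear; lia.
case: nt => [/eqP|nt]; first by rewrite (negPf gt0).
case: ns => [/eqP|ns]; first by rewrite (negPf gs0).
(* [G] sends [F y] back to [y], of order 3. Since [n (G t)] and [n (G cofiber(x))] are at most -1
   and add up to [n (G Y)], two factors [Y] absorb this 3 and still leave one [n (G cofiber(x))]. *)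
have nh : ord_le (G (pev iota x h)) (n (G (pev iota x cofiber))).
  have -> : pev iota x h = Y ^+ j.+2 * F y - Y * E (A1, B1, 0) by rewrite hE e1 addrK.
  rewrite rmorphB; apply: ord_leB; rewrite rmorphM.
    rewrite rmorphXn /= autK; right;
      rewrite ord_infM ?expf_neq0 ?y_neq0 // ord_infX // ord_inf_y nY.
    by move: nt ns; move: (n (G t)) (n (G (pev iota x cofiber))) => k l; clear; nia.
  apply: (@ord_leW _ (n (G Y) + 0)); last first.
    by rewrite nY; move: nt; move: (n (G t)) (n (G (pev iota x cofiber))) => k l;
      clear; lia.
  apply: ord_leM; first by right.
  by apply/PQ; apply: local_tev.
rewrite fmorph_div; have := ord_leM nh (k := - n (G (pev iota x cofiber))) (v := (G
  (pev iota x cofiber))^-1).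
by rewrite subrr; apply; right; rewrite ord_infV.
Qed.

Lemma pole_shape : exists al be, be != 0 /\ F y = iota al + iota be / Y.
Proof.
have Y0 := y_subC_neq0 y0.
(* At any pole of [F y], [G] turns this product into [(G Y)^3 y], whose order is at most
   [-3 + 3]. *)
have [r hr] : exists r, Y ^+ 3 * F y = E r.
  apply: regular_everywhere => x1 y1 hQ; have pQ := local_place hQ.
  have [hF|hF] := pselect (local_ring x1 y1 (F y)).
    apply: (placeM pQ) => //; apply: (placeX pQ).
    by rewrite -(pevX iota y) -(pevC iota y) -rmorphB; apply: local_ev.
  apply/(place_pole pQ hF); rewrite rmorphM rmorphXn /= autK.
  have := ord_leM (ord_leX 3 ord_le_GY) (m := (-1) * 3%:Z) (v := y) (k := 3).
  by apply; right; rewrite ord_inf_y.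
have : ord_le (E r) 9%N%:Z.
  rewrite -hr; have hY : ord_le Y 3 by right; rewrite ord_inf_yC.
  exact: (ord_leM (ord_leX 3 hY) Fy_inf).
move/ord_le_tev; case: r hr => [[A B] C] hr /and3P[/= hA hB hC].
have C0 : C = 0.
  by move: hC; rewrite /bdd => /orP[/eqP//|]; move: (sz C) (sz_gt0 C) hp4 => b;
    case: eqP => // _; clear; lia.
have sA : (sz A <= 4)%N.
  by move: hA; rewrite /bdd => /orP[/eqP->|];
    [rewrite /sz size_poly0 | move: (sz A) => b; clear; lia].
have sB : (sz B <= 2)%N.
  by move: hB; rewrite /bdd => /orP[/eqP->|];
    [rewrite /sz size_poly0 | move: (sz B) hp4 => b; clear; lia].
rewrite C0 in hr.
have [A1 eA sA1] := poly_XsubC_div A y0; have [B1 eB sB1] := poly_XsubC_div B y0.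
have [zA zB] := pole_step hr; rewrite zA addr0 in eA; rewrite zB addr0 in eB.
have hr1 : Y ^+ 2 * F y = E (A1, B1, 0).
  apply: (mulfI Y0); rewrite mulrA -exprS hr eA eB /tev /= !rmorphM !rmorphB /= pevX
    pevC rmorph0.
  by ring.
have [A2 eA1 sA2] := poly_XsubC_div A1 y0; have [B2 eB1 sB2] := poly_XsubC_div B1 y0.
have [zA1 zB1] := pole_step hr1; rewrite zA1 addr0 in eA1; rewrite zB1 addr0 in eB1.
(* [B] has degree at most 1, as [3 deg B + p <= 9], and is divisible by the square of [X - y0].
   [pole_step] requires two factors [Y], so it stops here with [A2] of degree at most 1. *)
have B20 : B2 = 0.
  by apply/eqP; rewrite -[_ == _]negbK -sz_gt0; move: sB sB1 sB2; clear; lia.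
have hr2 : Y * F y = ev A2.
  apply: (mulfI Y0); rewrite mulrA -expr2 hr1 eA1 eB1 B20 mulr0 tev_poly rmorphM
    rmorphB /= pevX pevC.
  by [].
have [A3 eA2 sA3] := poly_XsubC_div A2 y0.
have sA3' : (sz A3 <= 1)%N by move: sA sA1 sA2 sA3; clear; lia.
exists A3`_0, A2.[y0].
have e : F y = iota A3`_0 + iota A2.[y0] / Y.
  apply: (mulfI Y0); rewrite hr2 {1}eA2 rmorphD rmorphM rmorphB /= pevX !pevC.
  by rewrite {1}(size1_polyC sA3') pevC; field.
split=> //; apply/eqP => h; apply: (@Fy_nonconst A3`_0).
by rewrite e h rmorph0 mul0r addr0.
Qed.

(** By [pole_shape], [F y] has a pole at every point over [y0], and all its poles are one place. So
    [x0] is the only root of [cofiber]. *)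
Lemma pole_ramified : [/\ x0 = 0, a = 0 & y0 ^+ p = y0].
Proof.
have [al [be [be0 e]]] := pole_shape.
have Y0 := y_subC_neq0 y0.
have uniq x1 : root cofiber x1 -> x1 = x0.
  move=> rx1; have hQ := cofiber_root rx1.
  have pP := local_place hP; have pQ := local_place hQ.
  have hF : ~ local_ring x1 y0 (F y).
    move=> hF; move/eqP: be0; apply; apply: (pmaxC pQ).
    have -> : iota be = Y * (F y - iota al) by rewrite e; field.
    apply: (pmaxM pQ); first exact: pmax_y.
    by apply: (placeB pQ) => //; exact: (placeC pQ).
  have PP := place_pole pP hpole; have PQ := place_pole pQ hF.
  have m1 : pmax (local_ring x0 y0) (x - iota x1).
    by case: (pmax_t hQ) => [h|h]; [left|right => h'; apply: h; apply/PQ/PP].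
  have := pmaxB pP (pmax_t hP) m1.
  have -> : x - iota x0 - (x - iota x1) = iota (x1 - x0) by rewrite rmorphB; ring.
  by move/(pmaxC pP)/eqP; rewrite subr_eq0 => /eqP.
have [x1 rx1] : exists x1, root cofiber x1.
  by apply: closed_rootP; rewrite -/(sz _) sz_cofiber.
have r0 : root cofiber x0 by move: (rx1); rewrite (uniq _ rx1).
(* The roots of [cofiber] sum to [- x0], so the companion of [x0] is [-2 x0]; being equal, they give
   [3 x0 = 0]. *)
have r2 : root cofiber (- (2%:R * x0)).
  by move: r0; rewrite /root !cofiber_horner => /eqP h; apply/eqP; rewrite -h; ring.
have h3 : x0 = 0.
  have h : 3%:R * x0 = 0.
    transitivity (x0 - (- (2%:R * x0))); first by ring.
    by rewrite (uniq _ r2) subrr.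
  move/eqP: h; rewrite mulf_eq0 -(dvdn_pcharf hpK) => /orP[|/eqP//].
  by move/dvdn_leq => /(_ isT); move: hp4; clear; lia.
have a0 : a = 0.
  by move: r0; rewrite /root cofiber_horner h3 expr0n mul0r !add0r => /eqP.
split=> //; apply/eqP; rewrite -subr_eq0; apply/eqP.
by rewrite hP h3 a0 expr0n mul0r addr0.
Qed.
End Pole.

(** * Automorphisms for which [F y] has no affine pole *)

Section NoPole.
Hypothesis hreg : forall x0 y0, on_curve x0 y0 -> local_ring x0 y0 (F y).

Lemma Frel : F y ^+ p - F y = F x ^+ 3 + iota a * F x.
Proof. by rewrite -rmorphXn -rmorphB hxy rmorphD rmorphXn rmorphM /= autC. Qed.

(** [F y] lies in [K[x,y]] and is not constant, so it has a pole at infinity; thus [F] preserves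
    that place. *)
Lemma nopole_place z : ord_le (F z) 0 <-> ord_le z 0.
Proof.
have [r hr] := regular_everywhere hreg.
have h : ~ ord_le (F y) 0.
  rewrite hr => h; have [|c hc] := @ord_le2_const r; first exact: ord_leW h _.
  by apply: (@Fy_nonconst c); rewrite hr hc.
by rewrite (place_pole place_inf h) autK.
Qed.

Lemma ord_inf_invariant z : z != 0 -> n z = 0 -> n (F z) = 0.
Proof.
move=> z0 h; have : ord_le (F z) 0 by apply/nopole_place; right; rewrite h.
have : ord_le (F z^-1) 0 by apply/nopole_place; right; rewrite ord_infV // h.
have Fz0 : F z != 0 by rewrite fmorph_eq0.
rewrite fmorphV => -[/eqP|h1]; first by rewrite invr_eq0 (negPf Fz0).
case=> [/eqP|h2]; first by rewrite (negPf Fz0).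
by move: h1 h2; rewrite ord_infV //; move: (n _) => k; clear; lia.
Qed.

Lemma ord_inf_scale u z (k : nat) : u != 0 -> z != 0 -> n z = n u * k%:Z ->
  n (F z) = n (F u) * k%:Z.
Proof.
move=> u0 z0 h; have Fz0 : F z != 0 by rewrite fmorph_eq0.
have Fu0 : F u != 0 by rewrite fmorph_eq0.
have := @ord_inf_invariant (z / u ^+ k); rewrite mulf_neq0 ?invr_eq0 ?expf_neq0 //.
rewrite ord_infM ?invr_eq0 ?expf_neq0 // ord_infV ?expf_neq0 // ord_infX // h subrr =>
  /(_ isT erefl).
rewrite fmorph_div rmorphXn ord_infM ?invr_eq0 ?expf_neq0 // ord_infV ?expf_neq0 //
  ord_infX //.
by move/eqP; rewrite subr_eq0 => /eqP.
Qed.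

(** The pole orders 3 and [p] of [y] and [x] are coprime, so some monomial has a simple pole. *)
Lemma uniformizer : exists2 u, u != 0 & n u = 1.
Proof.
have x0 := x_neq0; have y0 := y_neq0.
have [k [hk|hk]] : exists k, (p = 3 * k + 1 \/ p = 3 * k + 2)%N.
  by exists (p %/ 3)%N; move: p_mod3; clear; lia.
- exists (x / y ^+ k); first by rewrite mulf_neq0 ?invr_eq0 ?expf_neq0.
  rewrite ord_infM ?invr_eq0 ?expf_neq0 // ord_infV ?expf_neq0 // ord_infX // ord_inf_x
    ord_inf_y hk; clear; lia.
- exists (y ^+ k.+1 / x); first by rewrite mulf_neq0 ?invr_eq0 ?expf_neq0.
  rewrite ord_infM ?invr_eq0 ?expf_neq0 // ord_infV // ord_infX // ord_inf_x ord_inf_y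
    hk; clear; lia.
Qed.

Lemma nopole_deg : n (F y) = 3 /\ n (F x) = p%:Z.
Proof.
have [u u0 nu] := uniformizer.
suff h : n (F u) = 1.
  rewrite (@ord_inf_scale u y 3) ?y_neq0 // ?ord_inf_y ?nu // (@ord_inf_scale u x p)
    ?x_neq0 // ?ord_inf_x ?nu //.
    by rewrite h !mul1r.
  by rewrite mul1r.
have w0 : G u != 0 by rewrite fmorph_eq0.
have hw : ~ ord_le (G u) 0.
  by move/nopole_place; rewrite autVK => -[/eqP|]; rewrite ?(negPf u0) // nu.
have {}hw : 0 < n (G u).
  by have [h|//] := lerP (n (G u)) 0; case: hw; right.
have [k hk] : exists k : nat, n (G u) = k%:Z.
  by exists (absz (n (G u))); move: hw; move: (n _) => m; clear; lia.
(* This yields [1 = n (F u) * k] with [k > 0], which forces [n (F u) = 1]. *)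
have := @ord_inf_scale u (G u) k u0 w0; rewrite nu mul1r autVK nu => /(_ hk).
move: (n (F u)) hw; rewrite hk; move=> m; clear; nia.
Qed.

(** Pole orders 3 and [p] leave [F y = ga y + dl] and [F x = w x + q(y)]. In the equation, the
    coefficient [3 w^2 q] of [x^2] must vanish, so [q = 0]; the other two coordinates give the
    conditions on [w], [ga] and [dl]. *)
Lemma nopole_shape : exists w dl,
  [/\ F x = iota w * x, F y = iota (w ^+ 3) * y + iota dl &
  [/\ w != 0, (w ^+ 3) ^+ p = w ^+ 3, a * w ^+ 2 = a & dl ^+ p = dl]].
Proof.
have [ny nx] := nopole_deg.
have [r hr] := regular_everywhere hreg.
have [r2 hr2] : exists r, F x = E r.
  apply: regular_everywhere => x0 y0 hQ; have pQ := local_place hQ.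
  apply: (place_integral pQ (k := 1) (c := a)); rewrite -Frel.
  by apply: (placeB pQ); [apply: (placeX pQ)|]; apply: hreg.
have : ord_le (E r) 3%N%:Z by right; rewrite -hr ny.
have : ord_le (E r2) p%:Z by right; rewrite -hr2 nx.
move/ord_le_tev; case: r2 hr2 => [[q B] C] hr2 /and3P[/= _ hB hC].
move/ord_le_tev; case: r hr => [[A B'] C'] hr /and3P[/= hA hB' hC'].
have zero (k m : nat) (s : {poly K}) : bdd s k m -> (m < k)%N -> s = 0.
  move=> h hm; apply/eqP; rewrite -[_ == _]negbK -sz_gt0; move: h.
  by rewrite /bdd => /orP[/eqP->|]; [rewrite /sz size_poly0 | move: (sz s) hm => b;
    clear; lia].
have C0 : C = 0 by apply: zero hC _; move: hp4; clear; lia.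
have C'0 : C' = 0 by apply: zero hC' _; move: hp4; clear; lia.
have B'0 : B' = 0 by apply: zero hB' _; move: hp4; clear; lia.
have sB : (sz B <= 1)%N.
  by move: hB; rewrite /bdd => /orP[/eqP->|];
    [rewrite /sz size_poly0 | move: (sz B) => b; clear; lia].
have sA : (sz A <= 2)%N.
  by move: hA; rewrite /bdd => /orP[/eqP->|];
    [rewrite /sz size_poly0 | move: (sz A) => b; clear; lia].
pose w := B`_0; have eB : B = w%:P by rewrite {1}(size1_polyC sB).
have [A1 eA sA1] := poly_XsubC_div A 0; rewrite subr0 in eA.
have [ga eA1] : exists ga, A1 = ga%:P.
  by exists A1`_0; apply: size1_polyC; rewrite -/(sz A1); move: sA sA1; clear; lia.
move: eA; rewrite eA1; move: A.[0] => dl eA.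
have eFx : F x = iota w * x + ev q.
  by rewrite hr2 C0 eB /tev /= pevC rmorph0; ring.
have eFy : F y = iota ga * y + iota dl.
  by rewrite hr C'0 B'0 tev_poly eA rmorphD rmorphM /= !pevC pevX mulrC.
(* With [w = 0] the order of [F x = q(y)] would be a multiple of 3, whereas it is [p]. *)
have w0 : w != 0.
  apply/eqP => h; move: nx; rewrite eFx h rmorph0 mul0r add0r -(tev_poly iota x).
  have q0 : (q, 0, 0) != (0, 0, 0) :> triple K.
    by rewrite -tev_eq0 tev_poly; move: eFx; rewrite h rmorph0 mul0r add0r => <-;
      rewrite fmorph_eq0 x_neq0.
  have q0' : q != 0 by apply: contra q0 => /eqP->.
  rewrite ord_inf_tev //; have -> : N (q, 0, 0) = q ^+ 3.
    by rewrite /tnorm; move: (cpoly _ _) => c; ring.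
  by rewrite szX //=; move: p_mod3; move: (sz q) => b; clear; lia.
have eL : F y ^+ p - F y = ev ((ga ^+ p)%:P * 'X^p - ga%:P * 'X + (dl ^+ p - dl)%:P).
  rewrite eFy -[iota dl]opprK frobenius_sub ?pchar_L // exprNn exprMn.
  have podd : odd p by have [h2|//] := even_prime hp; move: hp4; rewrite h2.
  have eXp : ev 'X^p = y ^+ p by rewrite rmorphXn /= pevX.
  rewrite -signr_odd podd rmorphD rmorphB /= pevC !rmorphM /= !pevC eXp pevX rmorphB
    !rmorphXn.
  by ring.
have eR : F x ^+ 3 + iota a * F x = E
   ((w ^+ 3)%:P * cpoly K p + q ^+ 3 + a%:P * q,
    3%:R * w%:P * q ^+ 2 + (a * w - w ^+ 3 * a)%:P, 3%:R * (w ^+ 2)%:P * q).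
  rewrite /tev /= !rmorphD /= !rmorphM /= pev_cpoly !pevC hxy eFx !rmorph_nat.
  by rewrite rmorphN rmorphM rmorphXn; ring.
have := Frel; rewrite eL eR -(tev_poly iota x) => /tev_inj [] e1 e2 e3.
have three : 3%:R != 0 :> K.
  rewrite -(dvdn_pcharf hpK); apply/negP => /dvdn_leq => /(_ isT).
  by move: hp4; clear; lia.
have q0 : q = 0.
  move/esym/eqP: e3; rewrite mulf_eq0 => /orP[|/eqP//].
  by rewrite -polyC_natr -polyCM polyC_eq0 mulf_eq0 expf_eq0 (negPf three) (negPf w0).
rewrite q0 expr0n /= !mulr0 !addr0 in e1.
rewrite q0 expr0n /= !mulr0 !add0r in e2.
have co i : ((ga ^+ p)%:P * 'X^p - ga%:P * 'X + (dl ^+ p - dl)%:P)`_i =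
  ((w ^+ 3)%:P * cpoly K p)`_i by rewrite e1.
have p1 : (p == 1)%N = false by apply/negbTE; move: hp4; clear; lia.
have p0 : (p == 0)%N = false by apply/negbTE; move: hp4; clear; lia.
have c0 := co 0%N; have c1 := co 1%N; have cp := co p.
move: c0 c1 cp; rewrite /cpoly !coefD !coefN !coefCM !coefB !coefC !coefXn !coefX /=.
rewrite eqxx p0 p1 ![(_ == p)%N]eq_sym p0 p1 /= !(mulr0, mulr1, subr0, addr0, add0r,
  sub0r, oppr0).
move=> c0 c1 cp.
have ega : ga = w ^+ 3 by apply/eqP; rewrite -eqr_opp c1 mulrN1.
exists w, dl; split.
- by rewrite eFx q0 rmorph0 addr0.
- by rewrite eFy ega.
- split=> //.
  + by rewrite -{1}ega cp.
  + have : a * w - w ^+ 3 * a = 0.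
      by apply/eqP; rewrite -polyC_eq0 -e2.
    move/eqP; rewrite subr_eq0 => /eqP h; apply: (mulfI w0).
    by rewrite [RHS]mulrC h; ring.
  + by apply/eqP; rewrite -subr_eq0 c0.
Qed.
End NoPole.
End Automorphism.

Lemma pole_at x1 y1 c b : on_curve x1 y1 -> b != 0 ->
  ~ local_ring x1 y1 (iota c + iota b / (y - iota y1)).
Proof.
move=> hQ b0 h; have pQ := local_place hQ; move/eqP: b0; apply; apply: (pmaxC pQ).
have Y0 := y_subC_neq0 y1.
have -> : iota b = (y - iota y1) * (iota c + iota b / (y - iota y1) - iota c) by field.
apply: (pmaxM pQ); first exact: pmax_y.
by apply: (placeB pQ) => //; exact: (placeC pQ).
Qed.

Lemma curve_point y1 : exists x1, on_curve x1 y1.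
Proof.
have [x1 /fiber_root h] : exists x1, root (fiber y1) x1.
  by apply: closed_rootP; rewrite -/(sz _) sz_fiber.
by exists x1.
Qed.

Lemma odd_p : odd p.
Proof. by have [h2|//] := even_prime hp; move: hp4; rewrite h2. Qed.

Lemma frobenius_add (R : comNzRingType) (u v : R) :
  p \in [pchar R] -> (u + v) ^+ p = u ^+ p + v ^+ p.
Proof. by move=> hR; rewrite exprDn_pchar // pnatE. Qed.

Lemma translation i : i ^+ p = i ->
  exists T T', aut_pair T T' /\ T x = x /\ T y = y + iota i.
Proof.
move=> hi; have [||f [hf fx fy]] := @Kaut_exists x (y + iota i).
- move=> S SC Sx Sy SD SN SM SV; apply: hgen => //.
  have -> : y = y + iota i + - iota i by rewrite addrK.
  by apply: SD => //; apply: SN.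
- rewrite frobenius_add ?pchar_L // -rmorphXn hi -hxy; ring.
have [T [T' [hT eT]]] := Kaut_rmorph hf.
by exists T, T'; rewrite !eT.
Qed.

Lemma pole_automorphism F G x0 y0 : aut_pair F G -> on_curve x0 y0 ->
  ~ local_ring x0 y0 (F y) -> exists w be k,
  [/\ a = 0, p = (3 * k + 2)%N, F y = iota be - iota (w ^+ 3) / (y - iota y0),
   F x = iota w * x / (y - iota y0) ^+ k.+1 &
  [/\ w != 0, (w ^+ 3) ^+ p = w ^+ 3, be ^+ p = be & y0 ^+ p = y0]].
Proof.
move=> FG hP hF; have [FK' GK' FC'] := FG.
have [_ a0 hy0] := pole_ramified FG hP hF.
have [al [be [be0 e]]] := pole_shape FG hP hF.
have Y0 := y_subC_neq0 y0; have Ya := y_subC_neq0 al.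
have be0' : iota be != 0 by rewrite fmorph_eq0.
(* Solving for the inverse gives [G y = y0 + be / (y - al)], to which [pole_ramified] applies over
   [al]. *)
have hal : al ^+ p = al.
  have eG : G y = iota y0 + iota be / (y - iota al).
    have := congr1 G e; rewrite FK' rmorphD fmorph_div rmorphB /= !(autVC FG) => eG.
    have g0 : G y - iota y0 != 0.
      by rewrite -(autVC FG y0) -rmorphB fmorph_eq0.
    have -> : y - iota al = iota be / (G y - iota y0) by rewrite {1}eG addrAC subrr
      add0r.
    by field; rewrite g0 be0'.
  have [x1 hQ] := curve_point al.
  have [] := pole_ramified (aut_pair_sym FG) hQ; last by [].
  by rewrite eG; apply: pole_at.
(* The translation by [y0 - al + 1] makes [F o T o F] send [y] to [al + be / (1 + be / Y)], whose
   pole lies over [y0 - be]; so [y0 - be] is in the prime field. *)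
have hbe : be ^+ p = be.
  have hi : (y0 - al + 1) ^+ p = y0 - al + 1.
    by rewrite (frobenius_add _ _ hpK) (frobenius_sub _ _ hpK) hy0 hal expr1n.
  have [T [T' [hT [_ Ty]]]] := translation hi.
  have [H1 [H1' [hH1 eH1]]] := aut_pair_comp FG hT.
  have [H [H' [hH eH]]] := aut_pair_comp hH1 FG.
  have [_ _ TC] := hT.
  have Yb := y_subC_neq0 (y0 - be).
  have eb : y - iota (y0 - be) = (y - iota y0) + iota be by rewrite rmorphB; ring.
  have eHy : H y = iota (al + be) + iota (- be ^+ 2) / (y - iota (y0 - be)).
    rewrite eH /= eH1 /= e !rmorphD !fmorph_div !rmorphB /= Ty !rmorphD /= !TC !FC' e.
    rewrite rmorph1 !rmorphN rmorphXn /=.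
    have h0 : y - iota y0 + iota be != 0 by rewrite -eb.
    have -> : iota al + iota be / (y - iota y0) + (iota y0 - iota al + 1) - iota y0 =
       (y - iota y0 + iota be) / (y - iota y0) by field.
    have -> : y - (iota y0 - iota be) = y - iota y0 + iota be by ring.
    by field; rewrite ?Y0 ?h0.
  have [x1 hQ] := curve_point (y0 - be).
  have [] := pole_ramified hH hQ.
    by rewrite eHy; apply: pole_at; rewrite // oppr_eq0 expf_neq0.
  move=> _ _; rewrite frobenius_sub // hy0 => /eqP.
  by rewrite (inj_eq (addrI _)) eqr_opp => /eqP.
have x_0 := x_neq0.
(* With all constants in the prime field, [x^3 = Y^p - Y] and [(F x)^3 = be (Y^-p - Y^-1)]. *)
have key : F x ^+ 3 * (y - iota y0) ^+ p.+1 = - iota be * x ^+ 3.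
  have := Frel FG; rewrite a0 rmorph0 mul0r addr0 => <-.
  have -> : x ^+ 3 = (y - iota y0) ^+ p - (y - iota y0).
    rewrite frobenius_sub ?pchar_L // -[iota y0 ^+ p]rmorphXn hy0.
    by rewrite opprB addrA subrK hxy a0 rmorph0 mul0r addr0.
  rewrite e frobenius_add ?pchar_L // expr_div_n -!rmorphXn hal hbe exprS.
  by field; rewrite Y0 expf_neq0.
have [k [hk|hk]] : exists k, (p = 3 * k + 1 \/ p = 3 * k + 2)%N.
  by exists (p %/ 3)%N; move: p_mod3; clear; lia.
(* Here [p + 1 = 3k + 2], so [W^3 = - be Y]: [W] would be regular on the affine curve with a simple
   pole at infinity, but 1 is a gap. *)
- exfalso; pose W := F x * (y - iota y0) ^+ k.+1 / x.
  have W3 : W ^+ 3 = iota (- be) * (y - iota y0).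
    have h : W ^+ 3 * x ^+ 3 = iota (- be) * (y - iota y0) * x ^+ 3.
      rewrite rmorphN [RHS]mulrAC -key.
      have -> : p.+1 = (3 * k + 2)%N by rewrite hk; clear; lia.
      rewrite exprD [(3 * k)%N]mulnC exprM /W [_ ^+ k.+1]exprS.
      by field.
    by apply: (mulIf _ h); rewrite expf_neq0.
  have [r hr] : exists r, W = E r.
    apply: regular_everywhere => x1 y1 hQ; have pQ := local_place hQ.
    apply: (place_root pQ (k := 2)); rewrite W3.
    apply: (placeM pQ); first exact: (placeC pQ).
    by rewrite -(pevX iota y) -(pevC iota y y0) -rmorphB; apply: local_ev.
  have be0n : - be != 0 by rewrite oppr_eq0.
  have W0 : W != 0.
    by rewrite !mulf_neq0 ?invr_eq0 ?expf_neq0 // fmorph_eq0.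
  have nW : n W = 1.
    have := congr1 n W3; rewrite ord_infX // ord_infM ?fmorph_eq0 // ord_inf_const //
      ord_inf_yC.
    by move: (n W) => m; clear; lia.
  have [|c hc] := @ord_le2_const r; first by right; rewrite -hr nW.
  have c0 : c != 0 by rewrite -(fmorph_eq0 iota) -hc -hr.
  by move: nW; rewrite hr hc ord_inf_const.
(* Here [p + 1 = 3(k + 1)], so [W^3 = - be]; being algebraic, [W] is a constant [w]. *)
- pose W := F x * (y - iota y0) ^+ k.+1 / x.
  have W3 : W ^+ 3 = iota (- be).
    have h : W ^+ 3 * x ^+ 3 = iota (- be) * x ^+ 3.
      rewrite rmorphN -key.
      have -> : p.+1 = (3 * k.+1)%N by rewrite hk; clear; lia.
      by rewrite [(3 * k.+1)%N]mulnC exprM /W; field.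
    by apply: (mulIf _ h); rewrite expf_neq0.
  have h0 : 'X^3 - (- be)%:P != 0 :> {poly K}.
    by rewrite -size_poly_gt0 size_XnsubC.
  have [|w hw rw] := closed_root (v := W) (j := iota) h0.
    rewrite rmorphB rmorphXn /= pevX pevC W3 subrr //.
  have hw3 : w ^+ 3 = - be.
    by move: rw; rewrite /root !hornerE subr_eq0 => /eqP.
  have w0 : w != 0.
    apply/eqP => h; move: hw3; rewrite h expr0n => /esym/eqP.
    by rewrite oppr_eq0 (negPf be0).
  exists w, al, k; split=> //.
  + by rewrite hw3 rmorphN mulNr opprK.
  + by rewrite -hw /W; field; rewrite x_0 expf_neq0.
  + split=> //; rewrite hw3 exprNn -signr_odd odd_p hbe; ring.
Qed.

(** * Counting *)

(** An automorphism is determined by the images of [x] and [y], so counting automorphisms is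
    counting these pairs. *)
Lemma aut_card_of_seq (s : seq (L * L)) : uniq s ->
  (forall f, is_Kaut iota f -> (f x, f y) \in s) ->
  (forall u, u \in s -> exists2 f, is_Kaut iota f & (f x, f y) = u) ->
  aut_card iota (size s).
Proof.
move=> us h1 h2.
have h3 (i : 'I_(size s)) : exists f, is_Kaut iota f /\ (f x, f y) = nth (0, 0) s i.
  by have [f hf e] := h2 _ (mem_nth (0, 0) (ltn_ord i)); exists f.
have [e he] := choice h3; exists e; split.
- by move=> i; case: (he i).
- move=> i j eij; apply: val_inj; apply/eqP;
  rewrite -(nth_uniq (0, 0) (ltn_ord i) (ltn_ord j) us).
  by case: (he i) => _ <-; case: (he j) => _ <-; rewrite eij.
- move=> f hf; have hi : (index (f x, f y) s < size s)%N by rewrite index_mem h1.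
  exists (Ordinal hi); case: (he (Ordinal hi)) => hK;
    rewrite /= nth_index ?h1 // => -[e1 e2].
  exact: Kaut_ext.
Qed.

Definition pair_fix (w dl : K) : L * L :=
  (iota w * x, iota (w ^+ 3) * y + iota dl).

(** Here [b] is the pair [(be, y0)]; with [p = 3k + 2] the exponent [k + 1] is [(p + 1) / 3]. *)
Definition pair_move (k : nat) (w : K) (b : K * K) : L * L :=
  (iota w * x / (y - iota b.2) ^+ k.+1, iota b.1 - iota (w ^+ 3) / (y - iota b.2)).

Lemma iota_inj : injective iota. Proof. exact: fmorph_inj. Qed.

Lemma pair_fix_inj w dl w' dl' : pair_fix w dl = pair_fix w' dl' ->
  (w, dl) = (w', dl').
Proof.
move=> [] /(mulIf x_neq0)/iota_inj -> /addrI/iota_inj -> //.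
Qed.

Lemma ev_horner0 q c : ev q = 0 -> q.[c] = 0.
Proof. by move/y_transc->; rewrite horner0. Qed.

Lemma pair_move_inj k w b w' b' : w != 0 -> pair_move k w b = pair_move k w' b' ->
  (w, b) = (w', b').
Proof.
case: b => be y0; case: b' => be' y0' w0 [] /=.
have Y0 := y_subC_neq0 y0; have Y0' := y_subC_neq0 y0'.
(* Clear denominators in the second components; the value at [y0] of the resulting zero polynomial
   is [- w^3 (y0 - y0')]. *)
move=> ex ey; have e1 : y0 = y0'.
  have : ev (((be - be')%:P * ('X - y0'%:P) + (w' ^+ 3)%:P) * ('X - y0%:P) -
     (w ^+ 3)%:P * ('X - y0'%:P)) = 0.
    have -> : ev (((be - be')%:P * ('X - y0'%:P) + (w' ^+ 3)%:P) * ('X - y0%:P) -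
     (w ^+ 3)%:P * ('X - y0'%:P)) = ((iota be - iota be') * (y - iota y0') +
       iota (w' ^+ 3)) * (y - iota y0) - iota (w ^+ 3) * (y - iota y0').
      by rewrite !(rmorphB, rmorphD, rmorphM) /= !pevC !pevX.
    have -> : iota be = iota be' - iota (w' ^+ 3) / (y - iota y0') + iota (w ^+ 3) / (y
      - iota y0).
      by rewrite -ey subrK.
    by field; rewrite Y0 Y0'.
  move/(ev_horner0 y0); rewrite !hornerE subrr mulr0 sub0r => /eqP.
  rewrite oppr_eq0 mulf_eq0 expf_eq0 (negPf w0) /= subr_eq0 => /eqP //.
rewrite -e1 in ex ey.
have {ex} ew : w = w'.
  apply: iota_inj; apply: (mulIf x_neq0).
  by apply: (mulIf _ ex); rewrite invr_eq0 expf_neq0.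
by move: ey; rewrite ew => /addIr/iota_inj ->; rewrite e1.
Qed.

Lemma pair_fix_move k w dl w' b : w' != 0 -> pair_fix w dl <> pair_move k w' b.
Proof.
case: b => be y0 w0 [] _ /= e; have Y0 := y_subC_neq0 y0.
have : ev (((w ^+ 3)%:P * 'X + dl%:P - be%:P) * ('X - y0%:P) + (w' ^+ 3)%:P) = 0.
  have -> : ev (((w ^+ 3)%:P * 'X + dl%:P - be%:P) * ('X - y0%:P) + (w' ^+ 3)%:P) =
    (iota (w ^+ 3) * y + iota dl - iota be) * (y - iota y0) + iota (w' ^+ 3).
    by rewrite !(rmorphB, rmorphD, rmorphM) /= !pevC !pevX.
  by rewrite e; field.
move/(ev_horner0 y0); rewrite !hornerE subrr mulr0 add0r => /eqP.
by rewrite expf_eq0 (negPf w0).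
Qed.

Lemma pair_fix_aut w dl : w != 0 -> (w ^+ 3) ^+ p = w ^+ 3 -> a * w ^+ 2 = a ->
  dl ^+ p = dl -> exists2 f, is_Kaut iota f & (f x, f y) = pair_fix w dl.
Proof.
move=> w0 w3 aw hdl; have iw0 : iota w != 0 by rewrite fmorph_eq0.
have [||f [hf fx fy]] := @Kaut_exists (iota w * x) (iota (w ^+ 3) * y + iota dl).
- move=> S SC Sx Sy SD SN SM SV; apply: hgen => //.
    have -> : x = iota w^-1 * (iota w * x) by rewrite fmorphV mulKf.
    exact: SM.
  have -> : y = iota (w ^+ 3)^-1 * ((iota (w ^+ 3) * y + iota dl) + - iota dl).
    by rewrite addrK fmorphV mulKf // fmorph_eq0 expf_neq0.
  by apply: SM => //; apply: SD => //; apply: SN.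
- rewrite frobenius_add ?pchar_L // exprMn -!rmorphXn w3 hdl.
  rewrite opprD addrACA subrr addr0 -mulrBr hxy exprMn rmorphXn -{2}aw rmorphM rmorphXn.
  by ring.
by exists f; rewrite // fx fy.
Qed.

Lemma pair_move_aut k w b : a = 0 -> p = (3 * k + 2)%N ->
  w != 0 -> (w ^+ 3) ^+ p = w ^+ 3 -> b.1 ^+ p = b.1 -> b.2 ^+ p = b.2 ->
  exists2 f, is_Kaut iota f & (f x, f y) = pair_move k w b.
Proof.
case: b => be y0 /= a0 hk w0 w3 hbe hy0.
have iw0 : iota w != 0 by rewrite fmorph_eq0.
have iw3 : iota (w ^+ 3) != 0 by rewrite fmorph_eq0 expf_neq0.
have Y0 := y_subC_neq0 y0.
pose u := iota w * x / (y - iota y0) ^+ k.+1.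
pose v := iota be - iota (w ^+ 3) / (y - iota y0).
have [||f [hf fx fy]] := @Kaut_exists u v.
- move=> S SC Sx Sy SD SN SM SV.
  have SY : S (y - iota y0).
    have -> : y - iota y0 = iota (w ^+ 3) * (iota be + - v)^-1.
      by rewrite /v opprB addrA [iota be + _]addrC addrK invfM invrK mulVKf.
    by apply: SM => //; apply: SV; apply: SD => //; apply: SN.
  have SX m : S ((y - iota y0) ^+ m).
    elim: m => [|m IH]; first by rewrite expr0 -(rmorph1 iota).
    by rewrite exprS; apply: SM.
  apply: hgen => //.
    have -> : x = iota w^-1 * (u * (y - iota y0) ^+ k.+1).
      by rewrite /u divfK ?expf_neq0 // fmorphV mulKf.
    by apply: (SM) => //; apply: SM.
  have -> : y = (y - iota y0) + iota y0 by rewrite subrK.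
  exact: SD.
- have ex : x ^+ 3 = (y - iota y0) ^+ p - (y - iota y0).
    rewrite frobenius_sub ?pchar_L // -[iota y0 ^+ p]rmorphXn hy0.
    by rewrite opprB addrA subrK hxy a0 rmorph0 mul0r addr0.
  rewrite /v /u a0 rmorph0 mul0r addr0 frobenius_sub ?pchar_L // expr_div_n -!rmorphXn
    hbe w3.
  rewrite expr_div_n exprMn ex -!rmorphXn -exprM.
  have -> : (k.+1 * 3 = p.+1)%N by rewrite hk; clear; lia.
  rewrite [_ ^+ p.+1]exprS; field.
  by rewrite Y0 expf_neq0.
by exists f; rewrite // fx fy.
Qed.

Section Count.
Variables (Fp M : seq K).
Hypotheses (uFp : uniq Fp) (sFp : size Fp = p) (hFp : forall c, c \in Fp = (c ^+ p ==
  c)).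
Hypotheses (uM : uniq M).
Hypothesis (hM : forall w, w \in M <->
  [/\ w != 0, (w ^+ 3) ^+ p = w ^+ 3 & a * w ^+ 2 = a]).

Definition fix_pairs := [seq pair_fix w dl | w <- M, dl <- Fp].
Definition move_pairs k :=
  [seq pair_move k w b | w <- M, b <- [seq (be, y0) | be <- Fp, y0 <- Fp]].

Lemma uniq_fix_pairs : uniq fix_pairs.
Proof.
apply: allpairs_uniq => // -[w dl] [w' dl'] _ _ /=; exact: pair_fix_inj.
Qed.

Lemma uniq_move_pairs k : uniq (move_pairs k).
Proof.
apply: allpairs_uniq => //; first by apply: allpairs_uniq => // -[? ?] [? ?].
move=> [w b] [w' b'] /allpairsP[[w1 b1] /= [/hM[w0 _ _] _ [-> _]]] _ /=.
exact: pair_move_inj.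
Qed.

Lemma mem_fix_pairs F G : aut_pair F G ->
  (forall x0 y0, on_curve x0 y0 -> local_ring x0 y0 (F y)) -> (F x, F y) \in fix_pairs.
Proof.
move=> FG hreg; have [w [dl [-> -> [w0 w3 aw hdl]]]] := nopole_shape FG hreg.
by apply/allpairsP; exists (w, dl); split=> //=; [apply/hM | rewrite hFp hdl].
Qed.

Lemma fix_pairs_aut u : u \in fix_pairs -> exists2 f, is_Kaut iota f & (f x, f y) = u.
Proof.
move=> /allpairsP[[w dl] /= [/hM[w0 w3 aw] hdl ->]]; apply: pair_fix_aut => //.
by apply/eqP; rewrite -hFp.
Qed.

(** By [pole_automorphism] an affine pole of [F y] requires [a = 0] and [p = 2] modulo 3, so only
    pairs [(w, dl)] remain. *)
Lemma aut_card_no_pole : a != 0 \/ (p %% 3 = 1)%N -> aut_card iota (size M * p).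
Proof.
move=> hc; rewrite -sFp -(size_allpairs pair_fix M Fp); apply: aut_card_of_seq.
- exact: uniq_fix_pairs.
- move=> f /Kaut_rmorph[F [G [FG hf]]]; rewrite -!hf; apply: (mem_fix_pairs FG).
  move=> x0 y0 hP; apply: contrapT => h.
  have [w [be [k [a0 hk _ _ _]]]] := pole_automorphism FG hP h.
  by case: hc; [rewrite a0 eqxx | rewrite hk; clear; lia].
- exact: fix_pairs_aut.
Qed.

(** Besides the stabilizer of infinity there is one automorphism for each [w] and each pair
    [(be, y0)] over the prime field. *)
Lemma aut_card_pole k : a = 0 -> p = (3 * k + 2)%N ->
  aut_card iota (size M * p + size M * (p * p)).
Proof.
move=> a0 hk.
have <- : size (fix_pairs ++ move_pairs k) = (size M * p + size M * (p * p))%N.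
  by rewrite size_cat !size_allpairs sFp.
apply: aut_card_of_seq.
- rewrite cat_uniq uniq_fix_pairs uniq_move_pairs andbT /=.
  apply/hasPn => _ /allpairsP[[w b] /= [/hM[w0 _ _] _ ->]].
  apply/negP => /allpairsP[[w' dl] /= [_ _ e]].
  by apply: (@pair_fix_move k w' dl w b w0).
- move=> f /Kaut_rmorph[F [G [FG hf]]]; rewrite -!hf mem_cat.
  have [h|] := pselect (forall x0 y0, on_curve x0 y0 -> local_ring x0 y0 (F y)).
    by rewrite (mem_fix_pairs FG h).
  move/existsNP => [x0 /existsNP[y0 /not_implyP[hP h]]].
  have [w [be [k' [_ hk' -> -> [w0 w3 hbe hy0]]]]] := pole_automorphism FG hP h.
  have <- : k = k' by move: hk'; rewrite hk; clear; lia.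
  apply/orP; right; apply/allpairsP; exists (w, (be, y0)); split=> //=.
    by apply/hM; rewrite a0 mul0r.
  by apply/allpairsP; exists (be, y0); rewrite !hFp hbe hy0 !eqxx.
- move=> u; rewrite mem_cat => /orP[/fix_pairs_aut//|].
  move=> /allpairsP[[w b] /= [/hM[w0 w3 _] hb ->]]; apply: pair_move_aut => //.
    by case/allpairsP: hb => -[be y0] /= [h1 _ ->] /=; apply/eqP; rewrite -hFp.
  by case/allpairsP: hb => -[be y0] /= [_ h1 ->] /=; apply/eqP; rewrite -hFp.
Qed.
End Count.

Lemma aut_fixes_inf O : is_place iota O -> ~ O y -> a != 0 \/ (p %% 3 = 1)%N ->
  aut_fixes iota O.
Proof.
move=> hO hy hc f /Kaut_rmorph[F [G [FG hf]]] z; rewrite -hf.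
have hreg x0 y0 : on_curve x0 y0 -> local_ring x0 y0 (F y).
  move=> hP; apply: contrapT => h.
  have [w [be [k [a0 hk _ _ _]]]] := pole_automorphism FG hP h.
  by case: hc; [rewrite a0 eqxx | rewrite hk; clear; lia].
rewrite (inf_unique hO hy) (inf_unique hO hy); apply: iff_sym.
exact: (nopole_place FG hreg).
Qed.
End FunctionField.

(** * Lists of roots in the constant field *)

Lemma closed_root_seq (K : closedFieldType) (q : {poly K}) :
  q \is monic -> separable_poly q ->
  exists s, [/\ uniq s, size s = (size q).-1 & forall z, z \in s = root q z].
Proof.
move=> mq sq; have [s] := closed_field_poly_normal q; rewrite (monicP mq) scale1r => hs.
exists s; split.
- by rewrite -separable_prod_XsubC -hs.
- by rewrite hs size_prod_XsubC.
- by move=> z; rewrite hs root_prod_XsubC.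
Qed.

Lemma unity_root_seq (K : closedFieldType) m : (0 < m)%N -> m%:R != 0 :> K ->
  exists s : seq K, [/\ uniq s, size s = m & forall z, z \in s = (z ^+ m == 1)].
Proof.
move=> m0 hm; have [|s [us ss hs]] := @closed_root_seq K ('X^m - 1) _
  (separable_Xn_sub_1 hm).
  by rewrite -polyC1 monicXnsubC.
exists s; split=> //; first by rewrite ss -polyC1 size_XnsubC.
by move=> z; rewrite hs /root !hornerE subr_eq0.
Qed.

Lemma prime_field_seq (K : closedFieldType) p : p \in [pchar K] ->
  exists s : seq K, [/\ uniq s, size s = p & forall z, z \in s = (z ^+ p == z)].
Proof.
move=> hp; have p1 : (1 < p)%N by rewrite prime_gt1 ?(pcharf_prime hp).
have sX : size ('X^p - 'X : {poly K}) = p.+1.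
  by rewrite size_polyDl ?size_polyXn // size_polyN size_polyX.
have [||s [us ss hs]] := @closed_root_seq K ('X^p - 'X).
- rewrite monicE lead_coefE sX coefB coefXn coefX eqxx.
  by have -> : (p == 1)%N = false by [apply/negbTE; rewrite neq_ltn p1 orbT];
    rewrite subr0.
- rewrite unlock derivB derivXn derivX -mulr_natr -polyC_natr (pcharf0 hp) polyC0 mulr0
  sub0r.
  by rewrite -[X in coprimep _ X]scaleN1r coprimepZr ?oppr_eq0 ?oner_neq0 // coprimep1.
exists s; split=> //; first by rewrite ss sX.
by move=> z; rewrite hs /root !hornerE subr_eq0.
Qed.

(** * Normal form of the equation and isomorphism with [C] *)

Lemma transcP (K : closedFieldType) (L : fieldType)
  (iota : {rmorphism K -> L}) (u : L) : transcendental iota u <-> forall c, u <> iota c.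
Proof.
split=> [h c hc|h q hq].
  have /h/eqP : (map_poly iota ('X - c%:P)).[u] = 0.
    by rewrite rmorphB /= map_polyX map_polyC !hornerE hc subrr.
  by rewrite polyXsubC_eq0.
apply/eqP; apply: contrapT => /negP q0.
by have [c hc _] := closed_root q0 hq; apply: (h c).
Qed.

(** [b = d / 3] completes the cube, leaving [a = e - 3 b^2], and [c] is a root of
    [c^p - c = b e - l - 2 b^3], which absorbs the constant term. *)
Lemma is_function_field_Z_depressed (K : closedFieldType) (L : fieldType)
  (iota : {rmorphism K -> L})
  p d e l (x y : L) :
  prime p -> (4 < p)%N -> p \in [pchar K] -> is_function_field_Z iota p d e l x y ->
  exists a b c, [/\ generates iota (x + iota b) (y + iota c),
    transcendental iota (x + iota b) &
    (y + iota c) ^+ p - (y + iota c) = (x + iota b) ^+ 3 + iota a * (x + iota b)].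
Proof.
move=> hp hp4 hpK [hg ht hr].
have three : 3%:R != 0 :> K.
  rewrite -(dvdn_pcharf hpK); apply/negP => /dvdn_leq => /(_ isT).
  by move: hp4; clear; lia.
pose b := d / 3%:R; have eb : d = 3%:R * b by rewrite /b mulrC divfK.
pose m := b * e - l - b ^+ 3 * 2%:R.
have [c hc] : exists c, c ^+ p - c = m.
  have [c hc] : exists c, root ('X^p - 'X - m%:P) c.
    apply/closed_rootP; rewrite -addrA size_polyDl ?size_polyXn.
      by rewrite eqSS -lt0n prime_gt0.
    by rewrite -opprD size_polyN size_XaddC ltnS prime_gt1.
  by exists c; move: hc; rewrite /root !hornerE subr_eq0 => /eqP.
exists (e - 3%:R * b ^+ 2), b, c; split.
- move=> S SC Sx Sy SD SN SM SV; apply: hg => //.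
    by have -> : x = x + iota b + - iota b by [rewrite addrK]; apply: (SD) => //;
      apply: SN.
  by have -> : y = y + iota c + - iota c by [rewrite addrK]; apply: (SD) => //;
    apply: SN.
- apply/transcP => k hk; move/transcP: ht => /(_ (k - b)); apply.
  by rewrite rmorphB -hk addrK.
- rewrite exprDn_pchar; last by rewrite pnatE // (rmorph_pchar iota hpK).
  have -> : y ^+ p + iota c ^+ p - (y + iota c) = (y ^+ p - y) + iota (c ^+ p - c).
    by rewrite rmorphB rmorphXn; ring.
  rewrite hr hc eb /m; ring.
Qed.

(** The isomorphism carries the generators of the function field of [C] into [L]. The term
    [iota 0 * x] makes this an instance of the normal form with [a = 0]. *)
Lemma iso_to_CP (K : closedFieldType) (L : fieldType)
  (iota : {rmorphism K -> L}) p : iso_to_C iota p <-> exists x y : L,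
  [/\ generates iota x y, transcendental iota x & y ^+ p - y = x ^+ 3 + iota 0 * x].
Proof.
split; last first.
  move=> [x [y [hg ht hr]]]; exists L, iota, x, y; split.
    by split=> //; rewrite hr rmorph0 !mul0r !addr0.
  by exists id; split=> //; exists id.
move=> [L' [j [x [y [[hg ht hr] [f [[g [fg gf]] fD fM f1 fC]]]]]]].
have f0 : f 0 = 0 by rewrite -(rmorph0 j) fC rmorph0.
have fN u : f (- u) = - f u by apply/eqP; rewrite -addr_eq0 -fD addrC subrr f0.
have fX u k : f (u ^+ k) = f u ^+ k.
  by elim: k => [|k IH]; rewrite ?expr0 // !exprS fM IH.
have fV u : f u^-1 = (f u)^-1.
  have [->|u0] := eqVneq u 0; first by rewrite invr0 f0 invr0.
  have fu0 : f u != 0 by apply: contra u0 => /eqP h; rewrite -(fg u) h -f0 fg.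
  by apply: (mulfI fu0); rewrite -fM !divff.
exists (f x), (f y); split.
- move=> S SC Sx Sy SD SN SM SV z; rewrite -(gf z).
  apply: (hg (fun z => S (f z))) => //.
  + by move=> c; rewrite fC.
  + by move=> u v hu hv; rewrite fD; apply: SD.
  + by move=> u hu; rewrite fN; apply: SN.
  + by move=> u v hu hv; rewrite fM; apply: SM.
  + by move=> u hu; rewrite fV; apply: SV.
- apply/transcP => c hc; move/transcP: ht => /(_ c); apply.
  by apply: (can_inj fg); rewrite fC.
- rewrite -!fX -fN -fD hr !fD !fM !fC !rmorph0 !mul0r !addr0 //.
Qed.
(** For nonzero [w], [w^(3(g+1)) = w^3] says [w^(3g) = 1], and [3g] is prime to the characteristic.
    The last condition is the case [a = 0] of the one imposed on [M]. *)
Lemma cube_unity_seq (K : closedFieldType) g :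
  (3 < g)%N -> prime g.+1 -> g.+1 \in [pchar K] ->
  exists s : seq K, [/\ uniq s, size s = (3 * g)%N & forall w, w \in s <->
   [/\ w != 0, (w ^+ 3) ^+ g.+1 = w ^+ 3 & 0 * w ^+ 2 = 0]].
Proof.
move=> hg hp hpK; have hm : (3 * g)%:R != 0 :> K.
  rewrite -(dvdn_pcharf hpK) Euclid_dvdM // negb_or.
  by apply/andP; split; apply/negP => /dvdn_leq; move: hg; clear; lia.
have [|s [us ss hs]] := unity_root_seq _ hm; first by move: hg; clear; lia.
have e3 (w : K) : (w ^+ 3) ^+ g.+1 = w ^+ 3 * w ^+ (3 * g) by rewrite exprS -exprM.
exists s; split=> // w; rewrite hs e3; split=> [/eqP h|[w0 h _]].
  split; rewrite ?h ?mulr1 ?mul0r //; apply/eqP => w0; move: h.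
  have e0 : (3 * g == 0)%N = false by apply/negbTE; move: hg; clear; lia.
  by rewrite w0 expr0n e0 => /esym/eqP; rewrite oner_eq0.
by apply/eqP; apply: (mulfI (expf_neq0 3 w0)); rewrite h mulr1.
Qed.

(** For [a] nonzero the last condition says [w^2 = 1], and then [w^p = w] because [p] is odd. *)
Lemma sign_seq (K : closedFieldType) p (a : K) :
  odd p -> (2 < p)%N -> p \in [pchar K] -> a != 0 ->
  exists s : seq K, [/\ uniq s, size s = 2%N & forall w, w \in s <->
   [/\ w != 0, (w ^+ 3) ^+ p = w ^+ 3 & a * w ^+ 2 = a]].
Proof.
move=> podd hp2 hpK a0; have h2 : 2%:R != 0 :> K.
  by rewrite -(dvdn_pcharf hpK); apply/negP => /dvdn_leq; move: hp2; clear; lia.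
have [//|s [us ss hs]] := unity_root_seq _ h2.
exists s; split=> // w; rewrite hs; split=> [/eqP h|[w0 _ h]]; last first.
  by apply/eqP; apply: (mulfI a0); rewrite h mulr1.
split; last by rewrite h mulr1.
  by apply/eqP => w0; move: h; rewrite w0 expr0n => /esym/eqP; rewrite oner_eq0.
have e : w ^+ p = w.
  by rewrite -(odd_double_half p) podd exprD expr1 -mul2n exprM h expr1n mulr1.
by rewrite exprAC e.
Qed.

Theorem theorem4p25 (K : closedFieldType) (g : nat)
  (hg : (2 < g)%N) (hprime : prime g.+1) (hchar : g.+1 \in [pchar K])
  (d e l : K) (L : fieldType) (iota : {rmorphism K -> L}) (x y : L)
  (hZ : is_function_field_Z iota g.+1 d e l x y) :
  (* Aut(Z) fixes P_oo, unless p = -1 mod 3 and Z is isomorphic to C *)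
  (forall Pinf : L -> Prop,
      is_place iota Pinf -> is_pole Pinf x -> is_pole Pinf y ->
      ~ ((g.+1 %% 3 = 2)%N /\ iso_to_C iota g.+1) ->
      aut_fixes iota Pinf) /\
  (* in that exceptional case |Aut C| = 3g(g+1)(g+2) *)
  (((g.+1 %% 3 = 2)%N /\ iso_to_C iota g.+1) ->
      aut_card iota (3 * g * g.+1 * g.+2)) /\
  (* if g = 0 mod 3, |Aut C| = 3g(g+1) *)
  (((g %% 3 = 0)%N /\ iso_to_C iota g.+1) ->
      aut_card iota (3 * g * g.+1)) /\
  (* otherwise |Aut Z| is p, 2p or 3p *)
  (~ iso_to_C iota g.+1 ->
      aut_card iota g.+1 \/ aut_card iota (2 * g.+1) \/ aut_card iota (3 * g.+1)).
Proof.
(* [g = 3] is excluded because 4 is not prime. *)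
have hg4 : (4 < g.+1)%N.
  by case: g hg hprime {hchar hZ} => [|[|[|[|n]]]].
have hg3 : (3 < g)%N by [].
have [a [b [c [hgen htr hr]]]] := is_function_field_Z_depressed hprime hg4 hchar hZ.
have [Fp [uFp sFp hFp]] := prime_field_seq hchar.
have [M [uM sM hM]] := cube_unity_seq hg3 hprime hchar.
have p3 := p_mod3 hprime hg4.
split; [|split; [|split]].
- move=> O hO _ hy hex.
  apply: (aut_fixes_inf hprime hg4 hchar hgen htr hr hO).
    move=> h; apply: hy; have -> : y = y + iota c - iota c by rewrite addrK.
    by apply: (placeB hO) => //; exact: (placeC hO).
  have [a0|a0] := eqVneq a 0; [right|by left].
  suff h2 : (g.+1 %% 3 <> 2)%N by move: p3 h2; clear; lia.
  move=> h2; apply: hex; split=> //; apply/iso_to_CP.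
  by rewrite a0 in hr; exists (x + iota b), (y + iota c).
- move=> [h2 /iso_to_CP[x1 [y1 [hgen1 htr1 hr1]]]].
  have [k hk] : exists k, g.+1 = (3 * k + 2)%N.
    by exists (g.+1 %/ 3)%N; move: h2; clear; lia.
  have := aut_card_pole hprime hg4 hchar hgen1 htr1 hr1 uFp sFp hFp uM hM (erefl 0) hk.
  by congr (aut_card _ _); rewrite sM; clear; lia.
- move=> [h0 /iso_to_CP[x1 [y1 [hgen1 htr1 hr1]]]].
  have h1 : (g.+1 %% 3 = 1)%N by move: h0; clear; lia.
  have := aut_card_no_pole hprime hg4 hchar hgen1 htr1 hr1 uFp sFp hFp uM hM (or_intror
    h1).
  by rewrite sM.
(* [a = 0] would give an isomorphism with [C]; for [a] nonzero the order is exactly [2(g+1)], the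
   middle alternative. *)
- move=> hiso; right; left.
  have a0 : a != 0.
    apply/eqP => a0; apply: hiso; apply/iso_to_CP; rewrite a0 in hr.
    by exists (x + iota b), (y + iota c).
  have [S [uS sS hS]] := sign_seq (odd_p hprime hg4) (ltnW (ltnW hg4)) hchar a0.
  have := aut_card_no_pole hprime hg4 hchar hgen htr hr uFp sFp hFp uS hS (or_introl
    a0).
  by rewrite sS.
Qed.
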